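(* Let $t<0$, let $\mathcal{A}\subseteq\mathbb{R}^p$ and $\mathcal{B}\subseteq\mathbb{R}^q$ be nonempty compact sets, and let $f:\mathbb{R}^n\times\mathcal{A}\times\mathcal{B}\to\mathbb{R}^n$ satisfy: (1) $f$ is continuous; (2) there exists $K>0$ such that $|f(x,a,b)|\le K(|x|+1)$ for all $x\in\mathbb{R}^n$, $a\in\mathcal{A}$, $b\in\mathcal{B}$; (3) for each $r>0$ there is $L_r>0$ such that $|f(x,a,b)-f(x',a,b)|\le L_r|x-x'|$ for all $a\in\mathcal{A}$, $b\in\mathcal{B}$ and all $x,x'\in\mathbb{R}^n$ with $|x|<r$ and $|x'|<r$; (4) for each $x\in\mathbb{R}^n$ and $a\in\mathcal{A}$, the set $f(x,a,\mathcal{B}):=\{f(x,a,b)\mid b\in\mathcal{B}\}$ is convex. Let $\mathbb{F}(t)\subseteq C([t,0])$ be closed in the uniform norm, and let $J:C([t,0])\to\mathbb{R}$ be a bounded and continuous functional such that $$\mathbb{F}(t)=\{\mathbf{x}\in C([t,0])\mid J[\mathbf{x}]\le 0\}.$$ Define $v(\cdot,t):\mathbb{R}^n\to\mathbb{R}$ by $$v(x,t)=\inf_{\gamma\in\Gamma(t)}\ \sup_{\mathbf{a}\in\mathfrak{A}(t)} J\left[\mathbf{x}_{x,t}^{\mathbf{a},\gamma[\mathbf{a}]}\right].$$ Define $$\mathcal{L}(t):=\left\{x\in\mathbb{R}^n\mid \forall\gamma\in\Gamma(t),\ \exists\mathbf{a}\in\mathfrak{A}(t),\ \mathbf{x}_{x,t}^{\mathbf{a},\gamma[\mathbf{a}]}\notin\mathbb{F}(t)\right\},$$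 $$\mathcal{G}(t):=\left\{x\in\mathbb{R}^n\mid \exists\gamma\in\Gamma(t),\ \forall\mathbf{a}\in\mathfrak{A}(t),\ \mathbf{x}_{x,t}^{\mathbf{a},\gamma[\mathbf{a}]}\in\mathbb{F}(t)\right\}.$$ Then $$\mathcal{L}(t)=\{x\in\mathbb{R}^n\mid v(x,t)>0\}\quad\text{and}\quad \mathcal{G}(t)=\{x\in\mathbb{R}^n\mid v(x,t)\le 0\}.$$
   Context: $|\cdot|$ is the Euclidean norm. $C([t,0])$ is the set of continuous maps $\mathbf{x}:[t,0]\to\mathbb{R}^n$ with norm $\|\mathbf{x}\|_\infty:=\max_{s\in[t,0]}|\mathbf{x}(s)|$; continuity of $J$ and closedness of $\mathbb{F}(t)$ are with respect to this norm. $\mathfrak{A}(t)$ is the set of Lebesgue measurable maps $[t,0]\to\mathcal{A}$ (control signals), and $\mathfrak{B}(t)$ is the set of Lebesgue measurable maps $[t,0]\to\mathcal{B}$ (disturbance signals). A map $\gamma:\mathfrak{A}(t)\to\mathfrak{B}(t)$ (a disturbance strategy) is non-anticipative if for each $\mathbf{a}_1,\mathbf{a}_2\in\mathfrak{A}(t)$ and each $s\in[t,0]$: whenever $\mathbf{a}_1(r)=\mathbf{a}_2(r)$ for a.e. $r\in[t,s]$, one has $\gamma[\mathbf{a}_1](r)=\gamma[\mathbf{a}_2](r)$ for a.e. $r\in[t,s]$. $\Gamma(t)$ is the set of all non-anticipative disturbance strategies. For $x\in\mathbb{R}^n$, $\mathbf{a}\in\mathfrak{A}(t)$, $\mathbf{b}\in\mathfrak{B}(t)$,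 $\mathbf{x}_{x,t}^{\mathbf{a},\mathbf{b}}:[t,0]\to\mathbb{R}^n$ denotes the unique absolutely continuous function $\mathbf{x}$ (Carathéodory solution) with $\mathbf{x}(t)=x$ and $\dot{\mathbf{x}}(s)=f(\mathbf{x}(s),\mathbf{a}(s),\mathbf{b}(s))$ for a.e. $s\in[t,0]$; under hypotheses (1)-(3) and compactness of $\mathcal{A},\mathcal{B}$, existence and uniqueness of this solution is a standard fact. *)

(* Defs.v *)
From HB Require Import structures.
From mathcomp Require Import all_boot all_order all_algebra.
From mathcomp Require Import all_classical all_reals all_analysis.
From mathcomp Require Import measurable_realfun.
Set Implicit Arguments.
Unset Strict Implicit.
Unset Printing Implicit Defensive.
Import Order.TTheory GRing.Theory Num.Theory.
Import numFieldNormedType.Exports.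
Local Open Scope classical_set_scope.
Local Open Scope ring_scope.

(* The library norm on row vectors is the maximum norm; it induces the same
   topology and uniformity as the Euclidean norm below. *)
Definition enorm (R : realType) (n : nat) (x : 'rV[R]_n) : R :=
  Num.sqrt (\sum_(i < n) x 0 i ^+ 2).

(* Maps on [t, 0] are represented by total functions on R of which only the
   values on [t, 0] matter. The topology of [paths] is that of uniform
   convergence on [t, 0], i.e. the one of the norm max_{[t, 0]} |x(s)|; it does
   not separate functions that agree on [t, 0], so closed sets and continuous
   functionals cannot distinguish them. *)
Notation paths R n t := {uniform` `[t, 0%R]%classic -> 'rV[R]_n}.

Definition continuous_paths (R : realType) (n : nat) (t : R) :
    set (paths R n t) :=
  [set x | {within `[t, 0], continuous (x : R -> 'rV[R]_n)}].
Arguments continuous_paths {R n} t _.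

(* Unions of a Borel set and a null set; on R, [measurable] only means Borel. *)
Definition lebesgue_measurable (R : realType) (E : set R) : Prop :=
  completed_algebra_gen (@lebesgue_measure R) E.

(* Used for both players: with the control set it gives the control signals,
   with the disturbance set the disturbance signals. *)
Definition signals (R : realType) (p : nat) (t : R) (A : set 'rV[R]_p) :
    set (R -> 'rV[R]_p) :=
  [set a | (forall s, s \in `[t, 0] -> A (a s)) /\
           (forall U : set 'rV[R]_p, open U ->
              lebesgue_measurable (`[t, 0] `&` a @^-1` U))].

(* Non-anticipative disturbance strategies. Taking s = 0 shows that, up to null
   sets, [gamma a] depends only on the restriction of [a] to [t, 0]. *)
Definition strategies (R : realType) (p q : nat) (t : R)
    (A : set 'rV[R]_p) (B : set 'rV[R]_q) :
    set ((R -> 'rV[R]_p) -> (R -> 'rV[R]_q)) :=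
  [set gamma |
    (forall a, signals t A a -> signals t B (gamma a)) /\
    (forall a1 a2 s, signals t A a1 -> signals t A a2 -> s \in `[t, 0] ->
       a1 = a2 %[ae lebesgue_measure in `[t, s]%classic] ->
       gamma a1 = gamma a2 %[ae lebesgue_measure in `[t, s]%classic])].

Definition absolutely_continuous (R : realType) (n : nat) (u v : R)
    (x : R -> 'rV[R]_n) : Prop :=
  forall e : R, 0 < e -> exists2 d : R, 0 < d &
    forall (m : nat) (l r : 'I_m -> R),
      (forall i, u <= l i <= r i /\ r i <= v) ->
      trivIset setT (fun i => `]l i, r i[%classic) ->
      \sum_(i < m) (r i - l i) < d ->
      \sum_(i < m) enorm (x (r i) - x (l i)) < e.

Section Dynamics.
Context {R : realType} {n p q : nat}.
Variable f : 'rV[R]_n -> 'rV[R]_p -> 'rV[R]_q -> 'rV[R]_n.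

Definition is_solution (t : R) (x0 : 'rV[R]_n)
    (a : R -> 'rV[R]_p) (b : R -> 'rV[R]_q) (x : R -> 'rV[R]_n) : Prop :=
  [/\ x t = x0,
      absolutely_continuous t 0 x &
      {ae lebesgue_measure, forall s, s \in `[t, 0] ->
         is_derive s 1 x (f (x s) (a s) (b s))}].

(* The Caratheodory solution, chosen classically (the constant path in case there is none).
   Solutions are unique on [t, 0] only, so the values elsewhere are arbitrary. *)
Definition trajectory (t : R) (x0 : 'rV[R]_n)
    (a : R -> 'rV[R]_p) (b : R -> 'rV[R]_q) : paths R n t :=
  xget (cst x0) (is_solution t x0 a b).

Variables (t : R) (A : set 'rV[R]_p) (B : set 'rV[R]_q).

Definition value (J : paths R n t -> R) (x : 'rV[R]_n) : R :=
  inf [set sup [set J (trajectory t x a (gamma a)) | a in signals t A]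
      | gamma in strategies t A B].

Definition losing_set (F : set (paths R n t)) : set 'rV[R]_n :=
  [set x | forall gamma, strategies t A B gamma ->
     exists2 a, signals t A a & ~ F (trajectory t x a (gamma a))].

Definition guaranteed_set (F : set (paths R n t)) : set 'rV[R]_n :=
  [set x | exists2 gamma, strategies t A B gamma &
     forall a, signals t A a -> F (trajectory t x a (gamma a))].

End Dynamics.

(* Main.v *)
Require Import Defs.
From HB Require Import structures.
From mathcomp Require Import all_boot all_order all_algebra.
From mathcomp Require Import all_classical all_reals all_analysis.
From mathcomp Require Import measurable_realfun.
From mathcomp Require Import ring lra.
Import Order.TTheory GRing.Theory Num.Theory.
Import numFieldNormedType.Exports.
Local Open Scope classical_set_scope.
Local Open Scope ring_scope.
Set Implicit Arguments.
Unset Strict Implicit.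
Unset Printing Implicit Defensive.

(** The inclusion of the guaranteed set in [v <= 0] and the duality of the two
    sets are elementary; the content is that an infimum [v(x) <= 0] is attained.
    Take strategies [gamma_k] whose trajectories [X_k(a)] all satisfy
    [J <= 1/(k+1)], and let [X(a)] be the limit of [X_k(a)] along one ultrafilter
    on the integers, the same for all [a]. The trajectories are equi-Lipschitz, so
    the limit is uniform and [J (X(a)) <= 0]; and as [X(a)] on [[t, s]] is
    determined by the [X_k(a)] there, [X] is again non-anticipative. Comparing
    support functions, convexity of the velocity sets gives
    [X(a)'(s) \in f(X(a)(s), a(s), B)] for almost every [s]. Finally
    [gamma(a)(s)] is the lexicographically least [b] in [B] with
    [f(X(a)(s), a(s), b) = X(a)'(s)]: this depends on the present only, so
    [gamma] is non-anticipative, it is measurable, and by uniqueness of solutions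
    it steers [a] along [X(a)]. *)

(** * Monotonicity from the sign of the derivative *)

Section Monotone.
Context {R : realType}.
Notation mu := (@lebesgue_measure R).

(** The limit is taken on trajectories because disturbance signals converge at best weakly, and a
    nonlinear [f] does not respect weak limits. The derivatives of the trajectories need not
    converge either; convexity of the velocity sets is what survives the averaging. A subsequence
    extracted by Arzela-Ascoli would depend on the signal, and an extraction that looks at the whole
    course of [a] would destroy non-anticipativity; a fixed ultrafilter gives all limits at once,
    and two limits can always be compared at a common index. For the same reason the recovered
    control has to be canonical: a selection whose mere existence is known for each [a] could depend
    at time [s] on the future of [a]. Every direction in which support functions are compared has
    its own null set of exceptional times, so only rational directions are used, and these must
    suffice for separation. *)

Lemma ae_imply (P Q : R -> Prop) :
  (forall x, P x -> Q x) -> {ae mu, forall x, P x} -> {ae mu, forall x, Q x}.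
Proof.
by move=> PQ; apply: (@filterS _ _ (ae_filter_ringOfSetsType mu)).
Qed.

Lemma ae_conj (P Q : R -> Prop) :
  {ae mu, forall x, P x} -> {ae mu, forall x, Q x} ->
  {ae mu, forall x, P x /\ Q x}.
Proof. exact: (@filterI _ _ (ae_filter_ringOfSetsType mu)). Qed.

Lemma ae_forall_countable (I : countType) (P : I -> R -> Prop) :
  (forall i, {ae mu, forall x, P i x}) -> {ae mu, forall x, forall i, P i x}.
Proof.
move=> aeP.
pose Q k x := if unpickle k is Some i then P i x else True.
have : mu.-negligible (\bigcup_k ~` [set x | Q k x]).
  apply: negligible_bigcup => k; rewrite /Q; case: unpickle => [i|]; first exact: aeP.
  by rewrite -[X in ~` X]/setT setCT; exact: negligible_set0.
apply: negligibleS => x /= /existsNP[i nP].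
by exists (pickle i) => //; rewrite /Q /= pickleK.
Qed.

(** The intervals form a list ordered from left to right, unlike the indexed families of
    [absolutely_continuous], because continuous induction appends them one by one at the right
    end. *)
Definition abs_cont (u v : R) (psi : R -> R) : Prop :=
  forall e : R, 0 < e -> exists2 d : R, 0 < d &
    forall s : seq (R * R),
      all (fun I => (u <= I.1 <= I.2) && (I.2 <= v)) s ->
      pairwise (fun I J => I.2 <= J.1) s ->
      \sum_(I <- s) (I.2 - I.1) < d ->
      \sum_(I <- s) `|psi I.2 - psi I.1| < e.

(** Without a quotient the estimate also holds at [y = x], and increments on the two sides of a
    point can be added by linear arithmetic. *)
Lemma is_derive_epsP (psi : R -> R) (x d : R) :
  is_derive x 1 psi d <->
  forall e, 0 < e -> exists2 r, 0 < r & forall y, `|y - x| < r ->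
    `|psi y - psi x - d * (y - x)| <= e * `|y - x|.
Proof.
split=> [[dpsi <-] e e0|h].
  have /cvgrPdist_le /(_ _ e0) := dpsi.
  move=> -[r /= r0 rP]; exists r => // y yr.
  have [->|yx] := eqVneq y x; first by rewrite !subrr mulr0 subr0 normr0 mulr0.
  have yx0 : y - x != 0 by rewrite subr_eq0.
  have := rP (y - x); rewrite /ball/= sub0r normrN => /(_ yr yx0).
  rewrite -[_ *: 1%R]/(_ * 1%R) mulr1 subrK -[_ *: _]/(_ * _) => H.
  rewrite (_ : psi y - psi x - 'D_1 psi x * (y - x) =
    (y - x) * - ('D_1 psi x - (y - x)^-1 * (psi y - psi x))).
    by rewrite normrM normrN mulrC ler_wpM2r.
  by field.
suff cv : h^-1 *: ((psi \o shift x) (h *: 1%R) - psi x) @[h --> 0^'] --> d.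
  by apply: DeriveDef; [apply/cvg_ex; exists d|exact: cvg_lim].
apply/cvgrPdist_le => e e0; have [r r0 rP] := h _ e0.
exists r => //= z; rewrite /ball/= sub0r normrN => zr z0.
have := rP (z + x); rewrite addrK => /(_ zr) H.
rewrite -[_ *: 1%R]/(_ * 1%R) mulr1 -[_ *: _]/(_ * _).
rewrite (_ : d - z^-1 * (psi (z + x) - psi x) =
    - z^-1 * (psi (z + x) - psi x - d * z)); last by field.
by rewrite normrM normrN normfV ler_pdivrMl ?normr_gt0// (mulrC `|z|).
Qed.

(** The step crosses [c] from a point on its left to one on its right, so at the supremum of the
    good points it leads from a good point just below to one beyond, or to [v]. *)
Lemma continuous_induction (P : R -> Prop) (u v : R) :
  u <= v -> P u ->
  (forall c, c \in `[u, v] -> exists2 d, 0 < d &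
     forall x y, u <= x -> x <= c -> c <= y -> y <= v ->
       c - d < x -> y < c + d -> P x -> P y) ->
  P v.
Proof.
move=> uv Pu step.
pose S := [set x | u <= x <= v /\ P x].
have Su : S u by split => //; rewrite lexx.
have supS : has_sup S by split; [exists u | exists v => x [/andP[]]].
pose c := sup S.
have cuv : u <= c <= v.
  apply/andP; split; first exact: ub_le_sup supS.2 _ Su.
  by apply: ge_sup; [exists u | move=> x [/andP[]]].
have /andP[uc cv] := cuv.
have [|d d0 stepc] := step c; first by rewrite in_itv.
have [x [/andP[ux xv] Px] cdx] := sup_adherent d0 supS.
have xc : x <= c by apply: ub_le_sup supS.2 _ _; split => //; rewrite ux.
have [vd|dv] := ltP v (c + d).
  exact: (stepc x v).
have cd2 : c < c + d / 2 by rewrite ltrDl divr_gt0.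
have : S (c + d / 2).
  have cdv : c + d / 2 <= v by apply: le_trans dv; lra.
  split; first by rewrite cdv andbT (le_trans uc)// ltW.
  by apply: (stepc x) => //; [exact: ltW|lra].
by move=> /(ub_le_sup supS.2); rewrite leNgt cd2.
Qed.

(* Continuous induction at a null set: exceptional points are absorbed by an open
   set of small measure, the increments over which are controlled by absolute continuity. *)
Lemma ae_derive_le0_le (u v : R) (psi : R -> R) :
  u <= v -> abs_cont u v psi ->
  {ae mu, forall s, s \in `[u, v] -> exists2 d, d <= 0 & is_derive s 1 psi d} ->
  psi v <= psi u.
Proof.
move=> uv acpsi [N [mN N0 NP]].
apply/ler_addgt0Pr => e e0.
(* A slope [e1] costs at most [e / 2] over [[u, v]]; the other half of [e] pays for the null set.
   The summand 1 covers the case [u = v]. *)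
pose e1 := e / (2 * (v - u + 1)).
have vu0 : 0 < v - u + 1 by lra.
have e10 : 0 < e1 by rewrite divr_gt0// mulr_gt0.
have e20 : 0 < e / 2 by rewrite divr_gt0.
have [d d0 acd] := acpsi _ e20.
have [|U [oU NU UNd]] := @lebesgue_regularity_outer R N d mN _ d0.
  by rewrite /= N0.
have mU : measurable U by exact: open_measurable.
have Ud : (mu U < d%:E)%E.
  rewrite -(setDKU NU).
  rewrite (@measureU _ _ _ mu); last 2 first.
  exact: mN.
  by rewrite setDKI.
  by rewrite -[X in (X < _)%E]/(mu (U `\` N) + mu N)%E N0 adde0.
  exact: measurableD.
(* The list [s] holds the intervals crossed around points of [N]. Their total length is charged to
   the part of [U] on the left of [x], so it stays below [d] at the end. *)
pose P x := exists s : seq (R * R), [/\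
  all (fun I => (u <= I.1 <= I.2) && (I.2 <= x)) s,
  pairwise (fun I J => I.2 <= J.1) s,
  ((\sum_(I <- s) (I.2 - I.1))%:E <= mu (U `&` `]u, x[))%E &
  psi x - psi u <= e1 * (x - u) + \sum_(I <- s) `|psi I.2 - psi I.1|].
have : P v.
  apply: (@continuous_induction P u v) => //.
    by exists [::]; split => //; rewrite !big_nil ?measure_ge0// !subrr mulr0 addr0.
  move=> c cuv.
  (* Near a point of [N] the interval from [x] to [y] lies in [U] and is appended to the list; near
     any other point the list is kept and the slope bound absorbs the increment. *)
  have [Nc|Nc] := pselect (N c).
    have /nbhs_ballP[r /= r0 rU] : nbhs c U by apply: open_nbhs_nbhs; split => //; exact: NU.
    exists r => // x y ux xc cy yv cx yc [s [s1 s2 s3 s4]].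
    have xy : x <= y by lra.
    exists (rcons s (x, y)); split.
    - rewrite all_rcons/= ux xy lexx/=; apply: sub_all s1 => I /andP[-> /= xI].
      exact: le_trans xI _.
    - rewrite pairwise_rcons s2 andbT; by apply: sub_all s1 => I /andP[_].
    - rewrite -cats1 big_cat/= big_seq1/= EFinD.
      apply: (@le_trans _ _ (mu ((U `&` `]u, x[) `|` `]x, y[))).
        rewrite measureU//=.
        + rewrite leeD// lebesgue_measure_itv/= lte_fin.
          by case: ifPn => //; rewrite -leNgt => yx; rewrite lee_fin subr_le0.
        + exact: measurableI.
        + rewrite -subset0 => z [[_ /=]]; rewrite !in_itv/= => /andP[_ zx] /andP[xz _].
          by have := lt_trans zx xz; rewrite ltxx.
      apply: le_measure; rewrite ?inE.
      + by apply: measurableU => //; exact: measurableI.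
      + exact: measurableI.
      + move=> z [[Uz]|] /=; rewrite !in_itv/= => /andP[z1 z2].
          by split => //; rewrite z1 (lt_le_trans z2).
        split; last by rewrite z2 (le_lt_trans ux).
        by apply: rU; rewrite /ball/= ltr_norml; apply/andP; split; lra.
    - rewrite -cats1 big_cat/= big_seq1/=.
      have : e1 * (x - u) <= e1 * (y - u) by rewrite ler_pM2l//; lra.
      have := ler_norm (psi y - psi x); lra.
  have [psi' psi'0 dpsi] : exists2 d, d <= 0 & is_derive c 1 psi d.
    have [//|h] := pselect (exists2 d, d <= 0 & is_derive c 1 psi d).
    by exfalso; apply/Nc/NP => /= /(_ cuv).
  have [r r0 rP] := (is_derive_epsP _ _ _).1 dpsi _ e10.
  exists r => // x y ux xc cy yv cx yc [s [s1 s2 s3 s4]].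
  exists s; split => //.
  - by apply: sub_all s1 => I /andP[-> /= xI]; apply: le_trans xI _; lra.
  - apply: (le_trans s3); apply: le_measure; rewrite ?inE; try exact: measurableI.
    by apply: setIS => z /=; rewrite !in_itv/= => /andP[-> zx]/=; lra.
  have := rP y; rewrite (ger0_norm (_ : 0 <= y - c)) ?subr_ge0// => /(_ ltac:(lra)).
  have := rP x; rewrite (ler0_norm (_ : x - c <= 0)) ?subr_le0// => /(_ ltac:(lra)).
  rewrite !ler_norml => /andP[h1 h2] /andP[h3 h4].
  have : psi' * (y - c) <= 0 by rewrite mulr_le0_ge0// subr_ge0.
  have : 0 <= psi' * (x - c) by rewrite mulr_le0// subr_le0.
  move: h1 h2 h3 h4 s4; set S1 := \sum_(_ <- _) _; nra.
move=> [s [s1 s2 s3 s4]].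
have : \sum_(I <- s) (I.2 - I.1) < d.
  rewrite -lte_fin; apply: (le_lt_trans s3); apply: le_lt_trans Ud.
  by apply: le_measure; rewrite ?inE//; exact: measurableI.
move=> /(acd s s1 s2) sume.
have : e1 * (v - u) <= e / 2.
  rewrite /e1 invfM mulrA -mulrA ler_piMr//; first exact: ltW.
  by rewrite mulrC ler_pdivrMr// mul1r; lra.
lra.
Qed.

End Monotone.

(** * Differentiability of Lipschitz functions, primitives *)

Section Lipschitz_derivable.
Context {R : realType}.
Notation mu := (@lebesgue_measure R).
Variable Y : R -> R.
Hypothesis Y1 : forall x y, `|Y x - Y y| <= `|x - y|.

Let f (x : R) := (x + Y x) / 2.
Let g (x : R) := (x - Y x) / 2.

Let f_nd : nondecreasing f.
Proof.
move=> x y xy; have := Y1 x y.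
by rewrite (@ler0_norm _ (x - y)) ?subr_le0// opprB ler_norml /f => /andP[]; lra.
Qed.

Let g_nd : nondecreasing g.
Proof.
move=> x y xy; have := Y1 x y.
by rewrite (@ler0_norm _ (x - y)) ?subr_le0// opprB ler_norml /g => /andP[]; lra.
Qed.

Let Y_cont : continuous Y.
Proof.
move=> x; apply/cvgrPdist_lt => e e0.
near=> y; apply: le_lt_trans (Y1 _ _) _.
by near: y; apply/nbhs_ballP; exists e.
Unshelve. all: by end_near. Qed.

Let f_rc : right_continuous f.
Proof.
apply: right_continuousW => x; apply: cvgM; last exact: cvg_cst.
by apply: cvgD; [exact: cvg_id|exact: Y_cont].
Qed.

Let g_rc : right_continuous g.
Proof.
apply: right_continuousW => x; apply: cvgM; last exact: cvg_cst.
by apply: cvgB; [exact: cvg_id|exact: Y_cont].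
Qed.

HB.instance Definition _ := isCumulative.Build R _ R f f_nd f_rc.
HB.instance Definition _ := isCumulative.Build R _ R g g_nd g_rc.

Let nuf := lebesgue_stieltjes_measure f.
Let nug := lebesgue_stieltjes_measure g.

Let stieltjes_itv (h : cumulative R R) (a b : R) : a <= b ->
  lebesgue_stieltjes_measure h `]a, b]%classic = (h b - h a)%:E.
Proof.
move=> ab; rewrite /lebesgue_stieltjes_measure /measure_extension/=.
by rewrite measurable_mu_extE/= ?wlength_itv_bnd//; exact: is_ocitv.
Qed.

Let lebesgueE (X : set R) : measurable X -> mu X = (nuf X + nug X)%E.
Proof.
move=> mX; rewrite -measure_addE.
apply: lebesgue_stieltjes_measure_unique => // _ [[a b] _ <-] /=.
have [ab|ba] := leP a b; last first.
  by rewrite set_itv_ge ?bnd_simp -?leNgt ?ltW// !measure0.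
rewrite [RHS]measure_addE stieltjes_itv// [X in (X + _)%E]stieltjes_itv//.
rewrite [X in (_ + X)%E]stieltjes_itv// -EFinD; congr EFin.
change (b - a = (b + Y b) / 2 - (a + Y a) / 2 + ((b - Y b) / 2 - (a - Y a) / 2)).
by field.
Qed.

Let nuf_dom : nuf `<< mu.
Proof.
apply/null_content_dominatesP => A mA A0.
have := lebesgueE mA; rewrite A0 => /esym/eqP.
by rewrite padde_eq0 ?measure_ge0// => /andP[/eqP].
Qed.

(* [f] and [g] are nondecreasing with sum the identity, so the Stieltjes measure of [f]
   is dominated by the Lebesgue measure; Lebesgue differentiation applies to its
   Radon-Nikodym density. *)
Lemma lipschitz1_derivable_ae (a b : R) : a < b ->
  {ae mu, forall s, s \in `]a, b[ -> derivable Y s 1}.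
Proof.
move=> ab.
have nuD : (nuf `]a, b]%classic < +oo)%E by rewrite [ltLHS]stieltjes_itv ?ltW// ltry.
have mD : measurable (`]a, b]%classic : set (measurableTypeR R)) by exact: measurable_itv.
(* Restriction to []a, b]] makes the measure finite, which gives an integrable density. *)
pose nu := mfrestr mD nuD.
have nudom : nu `<< mu.
  apply/null_content_dominatesP => A mA A0.
  have /null_content_dominatesP/(_ A mA A0) nA0 := nuf_dom.
  apply/eqP; rewrite eq_le measure_ge0 andbT -nA0.
  by rewrite /nu /mfrestr /mrestr le_measure ?inE//; exact: measurableI.
have [phi [phi0 phifin phiint phiE]] := radon_nikodym_sigma_finite nudom.
pose h := fine \o phi.
have hE : EFin \o h = phi by apply/funext => x /=; rewrite fineK.
have inth : mu.-integrable setT (EFin \o h) by rewrite hE.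
have := @FTC1 R h (BRight a).
have i1 y : mu.-integrable [set` Interval (BRight a) (BRight y)] (EFin \o h).
  by apply: integrableS inth.
move=> /(_ i1 (open_integrable_locally openT inth)) /=.
apply: ae_imply => s Fs.
rewrite in_itv/= => /andP[sa sb].
have {Fs}[Fs _] := Fs ltac:(by rewrite lte_fin).
pose F y := \int[mu]_(t in `]a, y]) h t.
have fE y : a < y < b -> f y = F y + f a.
  move=> /andP[ay yb]; apply/eqP; rewrite -subr_eq; apply/eqP.
  rewrite /F /Rintegral -[LHS]/(fine (f y - f a)%:E).
  congr fine; transitivity (nu `]a, y]%classic).
    rewrite /nu /mfrestr /mrestr (_ : `]a, y] `&` `]a, b] = `]a, y]%classic).
      by rewrite [RHS]stieltjes_itv ?ltW.
    by apply/setIidPl => z /=; rewrite !in_itv/= => /andP[-> zy] /=; lra.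
  apply: etrans (phiE _ _) _ => //; apply: eq_integral => z _.
  by rewrite -hE.
(* On []a, b[] one has [f = F + f a], and [Y] is recovered as twice [f] minus the identity. *)
have dY : derivable (2 *: (F + cst (f a)) - id) s 1.
  apply: derivableB; last exact: derivable_id.
  apply: derivableZ; apply: derivableD; last exact: derivable_cst.
  exact: Fs.
apply: near_eq_derivable dY.
have : s \in `]a, b[ by rewrite in_itv/= sa sb.
move=> /near_in_itvoo; apply: filterS => y; rewrite in_itv/= => /fE fy.
by rewrite -[LHS]/(2 * (F y + f a) - y) -fy /f; field.
Qed.

End Lipschitz_derivable.

Section Primitive.
Context {R : realType}.
Notation mu := (@lebesgue_measure R).

Lemma lipschitz_derivable_ae (Y : R -> R) (M a b : R) :
  (forall x y, `|Y x - Y y| <= M * `|x - y|) -> a < b ->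
  {ae mu, forall s, s \in `]a, b[ -> derivable Y s 1}.
Proof.
move=> YM ab.
(* [M] may be zero or negative here; [|M| + 1] is a Lipschitz constant by which one can divide. The
   same device recurs below. *)
have M1 : 0 < `|M| + 1 by rewrite ltr_wpDl.
have Y1 x y : `|(`|M| + 1)^-1 * Y x - (`|M| + 1)^-1 * Y y| <= `|x - y|.
  rewrite -mulrBr normrM normfV (gtr0_norm M1) ler_pdivrMl//.
  apply: le_trans (YM x y) _; rewrite ler_wpM2r//.
  by rewrite (le_trans (ler_norm M))// lerDl.
apply: ae_imply (lipschitz1_derivable_ae Y1 ab) => s ds sab.
have -> : Y = (fun x => (`|M| + 1) * ((`|M| + 1)^-1 * Y x)).
  by apply/funext => x; rewrite mulrA divff ?mul1r// gt_eqF.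
by apply: derivableM => //; exact: ds.
Qed.

Lemma lipschitz_primitive (g : R -> R) (M a b : R) :
  a < b -> measurable_fun setT g -> (forall x, `|g x| <= M) ->
  exists G : R -> R, [/\ G a = 0,
    forall x y, `|G x - G y| <= M * `|x - y| &
    {ae mu, forall s, s \in `[a, b] -> is_derive s 1 G (g s)}].
Proof.
move=> ab mg gM.
have M0 : 0 <= M := le_trans (normr_ge0 _) (gM 0).
(* The cut-off makes [g] integrable on the whole line, so the primitive can start at minus infinity
   and is Lipschitz everywhere. *)
pose h := g \_ `[a - 1, b + 1].
have mh : measurable_fun setT h.
  by apply/(measurable_restrictT _ _).1 => //; exact: measurable_funTS.
have hM x : `|h x| <= M by rewrite /h patchE; case: ifPn => // _; rewrite normr0.
have ih : mu.-integrable setT (EFin \o h).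
  rewrite /h -restrict_EFin; apply/integrable_restrict => //=; rewrite setTI.
  apply: measurable_bounded_integrable => //.
  - by rewrite /= lebesgue_measure_itv/=; case: ifPn => // _; rewrite -EFinB ltry.
  - exact: measurable_funTS.
  - by exists M; split; [exact: num_real|move=> x Mx y _; exact: le_trans (gM _) (ltW Mx)].
have iy y : mu.-integrable `]-oo, y] (EFin \o h) by exact: integrableS ih.
pose F x := \int[mu]_(t in `]-oo, x]) h t.
have FB x y : x <= y -> `|F y - F x| <= M * (y - x).
  move=> xy; rewrite /F Rintegral_itvB// ?bnd_simp//.
  have ixy : mu.-integrable `]x, y] (EFin \o h) by exact: integrableS ih.
  apply: le_trans (le_normr_Rintegral _ ixy) _ => //.
  have icst : mu.-integrable `]x, y] (EFin \o cst M).
    apply: measurable_bounded_integrable => //=.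
    - by rewrite /= lebesgue_measure_itv/=; case: ifPn => // _; rewrite -EFinB ltry.
    - by exists M; split; [exact: num_real|move=> z Mz w _ /=; rewrite ger0_norm//; exact: ltW].
  apply: (@le_trans _ _ (\int[mu]_(t in `]x, y]) M)).
    apply: le_Rintegral => //; exact: (integrable_norm ixy).
  rewrite Rintegral_cst//= ler_wpM2l// lebesgue_measure_itv/= lte_fin.
  by case: ifPn => //=; rewrite subr_ge0.
exists (fun x => F x - F a); split.
- by rewrite subrr.
- move=> x y; rewrite opprB addrA subrK.
  have [xy|/ltW yx] := leP x y; last by rewrite (@ger0_norm _ (x - y)) ?subr_ge0 ?FB.
  by rewrite distrC (distrC x) (@ger0_norm _ (y - x)) ?subr_ge0 ?FB.
- have := FTC1Ny iy (open_integrable_locally openT ih).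
  apply: ae_imply => s /= [dF F'] sab.
  have hs : h s = g s.
    rewrite /h patchE ifT// inE/= in_itv/=; move: sab; rewrite in_itv/= => /andP[*].
    by apply/andP; split; lra.
  rewrite -hs -F' derive1E; apply/is_derive_epsP => e e0.
  have [r r0 rP] := (is_derive_epsP F s _).1 (DeriveDef dF erefl) e e0.
  exists r => // y /rP; rewrite (_ : F y - F a - (F s - F a) = F y - F s)//.
  by ring.
Qed.

End Primitive.

(** * Absolutely continuous vector functions and growth estimates *)

Section Vectors.
Context {R : realType}.
Notation mu := (@lebesgue_measure R).

(** The projection onto [[a, b]]; composed with it, a path controlled only on [[t, 0]] becomes
    bounded and Lipschitz on the whole line. *)
Definition clamp (a b x : R) := Num.max a (Num.min x b).

Lemma clamp_itv a b x : a <= b -> a <= clamp a b x <= b.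
Proof. by move=> ab; rewrite /clamp le_max lexx/= ge_max ab/= ge_min lexx orbT. Qed.

Lemma clamp_id a b x : a <= x <= b -> clamp a b x = x.
Proof. by move=> /andP[ax xb]; rewrite /clamp min_l// max_r. Qed.

Lemma clamp_lipschitz a b x y : a <= b -> `|clamp a b x - clamp a b y| <= `|x - y|.
Proof.
move=> ab; wlog xy : x y / x <= y => [hw|].
  have [|/ltW] := leP x y; first exact: hw.
  by move=> /hw; rewrite distrC (distrC y).
rewrite (distrC x) (ger0_norm (_ : 0 <= y - x)) ?subr_ge0// ler_norml /clamp.
case: (leP x b) => h1; case: (leP y b) => h2;
  [case: (leP a x) => h3; case: (leP a y) => h4
  |case: (leP a x) => h3; case: (leP a b) => h4
  |case: (leP a b) => h3; case: (leP a y) => h4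
  |case: (leP a b) => h3]; apply/andP; split; lra.
Qed.

(** The sign of [c] matters for [n = 0], where the right-hand side is vacuous. *)
Lemma rV_norm_leP n (x : 'rV[R]_n) (c : R) : 0 <= c ->
  `|x| <= c <-> forall j, `|x 0 j| <= c.
Proof.
move=> c0; rewrite [`|x|]/Num.Def.normr/= mx_normrE; split => [xc j|xc].
  by apply: le_trans xc; exact: (le_bigmax _ (fun ij => `|x ij.1 ij.2|) (0, j)).
by apply: bigmax_le => // -[i j] _ /=; rewrite (ord1 i).
Qed.

Lemma coord_le_norm n (x : 'rV[R]_n) j : `|x 0 j| <= `|x|.
Proof. by move: j; apply/(rV_norm_leP x (normr_ge0 x)). Qed.

Lemma norm_le_enorm n (x : 'rV[R]_n) : `|x| <= enorm x.
Proof.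
apply/rV_norm_leP; first exact: sqrtr_ge0.
move=> j; rewrite -sqrtr_sqr ler_wsqrtr// (bigD1 j)//= lerDl sumr_ge0// => i _.
exact: sqr_ge0.
Qed.

(** The optimal factor is the square root of [n]; any factor will do for the transfer of hypotheses
    between the norms. *)
Lemma enorm_le_norm n (x : 'rV[R]_n) : enorm x <= n%:R * `|x|.
Proof.
have nx0 : 0 <= n%:R * `|x| by rewrite mulr_ge0.
rewrite -[leRHS]ger0_norm// -sqrtr_sqr ler_wsqrtr//.
apply: (@le_trans _ _ (\sum_(i < n) `|x| ^+ 2)).
  by apply: ler_sum => i _; rewrite -real_normK ?num_real// lerXn2r ?nnegrE// coord_le_norm.
rewrite sumr_const card_ord exprMn -[_ *+ n]mulr_natl ler_wpM2r ?sqr_ge0//.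
by rewrite -natrX ler_nat; case: n {x nx0} => // m; rewrite leq_pmulr.
Qed.

Lemma is_derive_coordP n (X : R -> 'rV[R]_n) (s : R) X' :
  is_derive s 1 X X' <-> forall j, is_derive s 1 (fun r => X r 0 j) (X' 0 j).
Proof.
split=> [[dX <-] j|dX].
  apply: DeriveDef; first exact: (derivable_mxP _ _ _).1.
  by rewrite derive_mx// mxE.
have dX1 : derivable X s 1.
  by apply/derivable_mxP => i j; rewrite (ord1 i); case: (dX j).
apply: DeriveDef => //; rewrite derive_mx//; apply/rowP => j; rewrite mxE.
by case: (dX j).
Qed.

Lemma abs_cont_sub (u v u' v' : R) psi : u <= u' -> v' <= v ->
  abs_cont u v psi -> abs_cont u' v' psi.
Proof.
move=> uu' vv' h e /h[d d0 hd]; exists d => // s sall; apply: hd.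
apply: sub_all sall => I /andP[/andP[h1 h2] h3].
by rewrite (le_trans uu')// h2 (le_trans h3).
Qed.

Lemma abs_cont_lipschitz (u v M : R) psi :
  (forall x y, u <= x -> x <= y -> y <= v -> `|psi y - psi x| <= M * (y - x)) ->
  abs_cont u v psi.
Proof.
move=> lip e e0; have M0 : 0 < `|M| + 1 by rewrite ltr_wpDl.
exists (e / (`|M| + 1)); first exact: divr_gt0.
move=> s sall _; rewrite ltr_pdivlMr// mulrC; apply: le_lt_trans.
rewrite mulr_sumr big_seq [leRHS]big_seq; apply: ler_sum => I /(allP sall).
move=> /andP[/andP[h1 h2] h3]; apply: le_trans (lip _ _ h1 h2 h3) _.
by rewrite ler_wpM2r ?subr_ge0// (le_trans (ler_norm M))// lerDl.
Qed.

Lemma abs_contD (u v : R) phi psi : abs_cont u v phi -> abs_cont u v psi ->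
  abs_cont u v (fun s => phi s + psi s).
Proof.
move=> h1 h2 e e0; have e20 : 0 < e / 2 by rewrite divr_gt0.
have [d1 d10 hd1] := h1 _ e20; have [d2 d20 hd2] := h2 _ e20.
exists (Num.min d1 d2); first by rewrite lt_min d10.
move=> s sall sp; rewrite lt_min => /andP[s1 s2].
rewrite (splitr e); apply: le_lt_trans (ltrD (hd1 _ sall sp s1) (hd2 _ sall sp s2)).
rewrite -big_split/=; apply: ler_sum => I _.
by rewrite opprD addrACA ler_normD.
Qed.

Lemma abs_contZ (u v c : R) psi : abs_cont u v psi ->
  abs_cont u v (fun s => c * psi s).
Proof.
move=> h e e0; have c0 : 0 < `|c| + 1 by rewrite ltr_wpDl.
have [|d d0 hd] := h (e / (`|c| + 1)); first exact: divr_gt0.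
exists d => // s sall sp sd; have := hd _ sall sp sd; rewrite ltr_pdivlMr// mulrC.
apply: le_lt_trans; rewrite mulr_sumr; apply: ler_sum => I _.
by rewrite -mulrBr normrM ler_wpM2r// lerDl.
Qed.

(** Successive intervals of an ordered list have disjoint interiors, so its positions index an
    admissible family. *)
Lemma abs_cont_coord n (u v : R) (x : R -> 'rV[R]_n) j :
  absolutely_continuous u v x -> abs_cont u v (fun s => x s 0 j).
Proof.
move=> h e /h[d d0 hd]; exists d => // s sall sp sd.
pose l (i : 'I_(size s)) := (nth (0, 0) s i).1.
pose r (i : 'I_(size s)) := (nth (0, 0) s i).2.
have big (F : R * R -> R) : \sum_(I <- s) F I = \sum_(i < size s) F (l i, r i).
  by rewrite (big_nth (0, 0)) big_mkord; apply: eq_bigr => i _; rewrite -surjective_pairing.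
have lr i : (l i <= r i) && ((u <= l i) && (r i <= v)).
  have := all_nthP (0, 0) sall i (ltn_ord i).
  by rewrite /l /r => /andP[/andP[-> ->] ->].
apply: le_lt_trans (hd (size s) l r _ _ _).
- rewrite big; apply: ler_sum => i _ /=; apply: le_trans (norm_le_enorm _).
  by apply: le_trans (coord_le_norm _ j); rewrite !mxE.
- by move=> i; have /andP[h1 /andP[h2 h3]] := lr i; rewrite h1 h2 h3.
- have ltij (i i' : 'I_(size s)) z : (i < i')%N -> `]l i, r i[%classic z ->
      `]l i', r i'[%classic z -> False.
    move=> ii' /=; rewrite !in_itv/= => /andP[_ zr] /andP[lz _].
    have := pairwiseP (0, 0) sp i i' (ltn_ord i) (ltn_ord i') ii'.
    rewrite -/(r i) -/(l i') => rl.
    by have := lt_trans (lt_le_trans zr rl) lz; rewrite ltxx.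
  move=> i i' _ _ [z [zi zi']]; apply/val_inj => /=.
  by case: (ltngtP i i') => // [/ltij/(_ zi zi')|/ltij/(_ zi' zi)].
- by rewrite big in sd.
Qed.

Lemma absolutely_continuous_lipschitz n (u v M : R) (x : R -> 'rV[R]_n) :
  (forall s r, `|x s - x r| <= M * `|s - r|) -> absolutely_continuous u v x.
Proof.
move=> lip e e0.
have nM0 : 0 < n%:R * `|M| + 1 by rewrite ltr_wpDl// mulr_ge0.
exists (e / (n%:R * `|M| + 1)); first exact: divr_gt0.
move=> m l r lr _; rewrite ltr_pdivlMr// mulrC; apply: le_lt_trans.
rewrite mulr_sumr; apply: ler_sum => i _; have [/andP[h1 h2] _] := lr i.
apply: le_trans (enorm_le_norm _) _.
apply: (@le_trans _ _ (n%:R * (`|M| * (r i - l i)))).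
  rewrite ler_wpM2l//; apply: le_trans (lip _ _) _.
  by rewrite (@ger0_norm _ (r i - l i)) ?subr_ge0// ler_wpM2r ?subr_ge0// ler_norm.
by rewrite mulrA ler_wpM2r ?subr_ge0// lerDl.
Qed.

Lemma absolutely_continuous_modulus n (u v : R) (x : R -> 'rV[R]_n) :
  absolutely_continuous u v x -> forall e, 0 < e -> exists2 d, 0 < d &
  forall r s, r \in `[u, v] -> s \in `[u, v] -> `|r - s| < d -> `|x r - x s| < e.
Proof.
move=> acx e /acx[d d0 hd]; exists d => //.
have key r s : u <= r -> r <= s -> s <= v -> s - r < d -> `|x s - x r| < e.
  move=> ur rs sv rsd; apply: le_lt_trans (norm_le_enorm _) _.
  have := hd 1%N (fun=> r) (fun=> s); rewrite !big_ord1; apply => //.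
  - by move=> _; rewrite ur rs sv.
  - by move=> i j _ _ _; rewrite (ord1 i) (ord1 j).
move=> r s; rewrite !in_itv/= => /andP[ur rv] /andP[us sv].
have [rs|/ltW sr] := leP r s.
  by rewrite distrC (distrC (x r)) ger0_norm ?subr_ge0// => h; exact: key.
by rewrite ger0_norm ?subr_ge0// => h; exact: key.
Qed.

Lemma absolutely_continuous_within n (u v : R) (x : R -> 'rV[R]_n) :
  absolutely_continuous u v x -> {within `[u, v], continuous x}.
Proof.
move=> /absolutely_continuous_modulus acx.
apply/subspace_continuousP => s suv; apply/cvgrPdist_lt => e /acx[d d0 hd].
have := nbhsx_ballx s d d0; rewrite near_withinE.
by apply: filterS => r sr ruv; exact: hd.
Qed.

Lemma within_continuous_bounded n (u v : R) (x : R -> 'rV[R]_n) :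
  {within `[u, v], continuous x} ->
  exists2 C, 0 <= C & forall s, s \in `[u, v] -> `|x s| <= C.
Proof.
move=> cx; have : compact (x @` `[u, v]).
  by apply: continuous_compact => //; exact: segment_compact.
move=> /compact_bounded[M [_ HM]]; exists (`|M| + 1); first by rewrite addr_ge0.
move=> s suv; apply: HM; first by rewrite ltr_pwDr// ler_norm.
by exists s.
Qed.

(** The tangent to the exponential at [y] lies below its graph. *)
Lemma expRB_le (x y : R) : x <= y -> expR y - expR x <= expR y * (y - x).
Proof.
move=> xy; have -> : expR x = expR y * expR (x - y) by rewrite -expRD subrKC.
rewrite -[X in X - _]mulr1 -mulrBr ler_wpM2l ?expR_ge0//.
by have := expR_ge1Dx (x - y); lra.
Qed.

(* In the norm weighted by this exponential, integrating an [L]-Lipschitz bound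
   contracts by a factor [1/2]. *)
Definition gauge (L u s : R) := expR (2 * L * (s - u)).

Lemma gauge_ge1 L u s : 0 <= L -> u <= s -> 1 <= gauge L u s.
Proof. by move=> L0 us; rewrite -expR0 ler_expR !mulr_ge0// subr_ge0. Qed.

(** The function [c / 2 * gauge L u] has derivative [L * c * gauge L u]; subtracted from a
    coordinate of [D] taken with either sign, it leaves a nonpositive derivative almost
    everywhere. *)
Lemma growth_halving n (D : R -> 'rV[R]_n) (L c u v : R) :
  0 < L -> 0 <= c -> (forall j, abs_cont u v (fun s => D s 0 j)) -> D u = 0 ->
  {ae mu, forall s, s \in `[u, v] ->
     exists2 d, is_derive s 1 D d & `|d| <= L * c * gauge L u s} ->
  forall s, s \in `[u, v] -> `|D s| <= c / 2 * gauge L u s.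
Proof.
move=> L0 c0 acD Du aeD s; rewrite in_itv/= => /andP[us sv].
pose B r := c / 2 * gauge L u r.
have acB : abs_cont u s (fun r => -1 * B r).
  apply: abs_contZ; apply: (@abs_cont_lipschitz _ _ (c / 2 * (gauge L u s * (2 * L)))).
  move=> x y ux xy ys; rewrite /B -mulrBr normrM ger0_norm ?divr_ge0// -mulrA.
  rewrite ler_wpM2l ?divr_ge0//.
  have xy2 : 2 * L * (x - u) <= 2 * L * (y - u).
    by rewrite ler_wpM2l ?mulr_ge0 ?(ltW L0)// lerD2r.
  rewrite ger0_norm; last by rewrite subr_ge0 ler_expR.
  apply: le_trans (expRB_le xy2) _.
  rewrite -mulrBr (_ : y - u - (x - u) = y - x); last by ring.
  rewrite [leRHS](_ : _ = gauge L u s * (2 * L * (y - x))); last by ring.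
  rewrite ler_wpM2r ?mulr_ge0 ?subr_ge0 ?(ltW L0)//.
  by rewrite ler_expR ler_wpM2l ?mulr_ge0 ?(ltW L0)// lerD2r.
have dB (r : R) : is_derive r 1 B (L * c * gauge L u r).
  have d1 : is_derive r 1 (fun x : R => 2 * L * (x - u)) (2 * L).
    apply/is_derive_epsP => e e0; exists 1 => // y _.
    rewrite (_ : 2 * L * (y - u) - 2 * L * (r - u) - 2 * L * (y - r) = 0).
      by rewrite normr0 mulr_ge0// ltW.
    by ring.
  have d2 := is_derive1_comp (is_derive_expR _) d1.
  have d3 := is_deriveZ (c / 2) d2.
  apply: (is_derive_eq d3).
  by rewrite /gauge /GRing.scale/=; field.
have key (sg : R) j : `|sg| <= 1 -> sg * D s 0 j <= B s.
  move=> sg1.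
  have := @ae_derive_le0_le R u s (fun r => sg * D r 0 j + -1 * B r) us.
  rewrite Du mxE mulr0 add0r => H.
  have {}H : sg * D s 0 j + -1 * B s <= -1 * B u.
    apply: H; first by apply: abs_contD => //; apply: abs_contZ; exact: abs_cont_sub (acD j).
    apply: ae_imply aeD => r h; rewrite in_itv/= => /andP[ur rs].
    have [|d dD db] := h; first by rewrite in_itv/= ur (le_trans rs).
    exists (sg * d 0 j + -1 * (L * c * gauge L u r)).
      rewrite mulN1r subr_le0; apply: le_trans db; apply: le_trans (coord_le_norm _ j).
      rewrite (le_trans (ler_norm _))// normrM ler_piMl//.
    have dj := (is_derive_coordP _ _ _).1 dD j.
    apply: is_deriveD.
  have : 0 <= B u by rewrite mulr_ge0 ?expR_ge0// divr_ge0.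
  lra.
apply/rV_norm_leP; first by rewrite mulr_ge0 ?expR_ge0// divr_ge0.
move=> j; rewrite ler_norml; apply/andP; split.
  by rewrite lerNl -mulN1r; apply: key; rewrite normrN1.
by rewrite -[leLHS]mul1r; apply: key; rewrite normr1.
Qed.

Lemma exists_half_pow_lt (a e : R) : 0 < e -> exists k, a / 2 ^+ k < e.
Proof.
move=> e0; exists (Num.bound (a / e)).
by rewrite ltr_pdivrMr ?exprn_gt0// mulrC -ltr_pdivrMr// upper_nthrootP.
Qed.

(** From the crude bound [C], each use of [growth_halving] halves the excess of the constant over
    [c], so [C] disappears in the limit. *)
Lemma gronwall n (D : R -> 'rV[R]_n) (L c C u v : R) :
  0 < L -> 0 <= c -> 0 <= C -> (forall j, abs_cont u v (fun s => D s 0 j)) -> D u = 0 ->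
  (forall s, s \in `[u, v] -> `|D s| <= C) ->
  {ae mu, forall s, s \in `[u, v] ->
     exists2 d, is_derive s 1 D d & `|d| <= L * (`|D s| + c)} ->
  forall s, s \in `[u, v] -> `|D s| <= c * gauge L u s.
Proof.
move=> L0 c0 C0 acD Du DC aeD.
have P k : forall s, s \in `[u, v] -> `|D s| <= (c + C / 2 ^+ k) * gauge L u s.
  elim: k => [|k IH] s suv.
    have su : u <= s by move: suv; rewrite in_itv/= => /andP[].
    rewrite expr0 divr1; apply: le_trans (DC _ suv) _.
    by rewrite (@le_trans _ _ (c + C)) ?lerDr// ler_peMr ?addr_ge0// gauge_ge1// ltW.
  have CK : 0 <= C / 2 ^+ k by rewrite divr_ge0// exprn_ge0.
  rewrite (_ : c + _ = (c + C / 2 ^+ k + c) / 2); last first.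
    by rewrite exprS; field; rewrite expf_neq0.
  apply: growth_halving acD Du _ _ suv => //; first by rewrite !addr_ge0.
  apply: ae_imply aeD => r h ruv; have [d dD db] := h ruv; exists d => //.
  have ur : u <= r by move: ruv; rewrite in_itv/= => /andP[].
  apply: le_trans db _; rewrite -mulrA ler_wpM2l ?(ltW L0)// mulrDl lerD ?IH//.
  by rewrite ler_peMr// gauge_ge1// ltW.
move=> s suv; apply/ler_addgt0Pr => e e0.
have [k /ltW ke] := exists_half_pow_lt (C * gauge L u s) e0.
apply: le_trans (P k _ suv) _; rewrite mulrDl lerD2l; apply: le_trans ke.
by rewrite mulrAC.
Qed.

End Vectors.

(** * Borel vector functions *)

Section Borel.
Context {R : realType}.
Notation mu := (@lebesgue_measure R).

(** Open cubes with rational centres: a countable base, through which the preimage of any open set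
    becomes a countable union. *)
Definition rV_box n (i : 'rV[rat]_n * nat) : set 'rV[R]_n :=
  [set x | forall j, `|x 0 j - ratr (i.1 0 j)| < i.2.+1%:R^-1].

Lemma rV_box_basis n (x : 'rV[R]_n) (e : R) : 0 < e ->
  exists i, rV_box i x /\ forall y, rV_box i y -> `|y - x| < e.
Proof.
move=> e0; pose k := Num.bound (2 / e).
have k2 : k.+1%:R^-1 < e / 2.
  rewrite -[ltRHS]invrK ltf_pV2 ?posrE ?invr_gt0 ?divr_gt0// invf_div.
  by rewrite (lt_trans (archi_boundP _)) ?ltr_nat// divr_ge0// ltW.
have k0 : 0 < k.+1%:R^-1 :> R by rewrite invr_gt0.
have cP j : exists q : rat, `|x 0 j - ratr q| < k.+1%:R^-1.
  have [|q] := @rat_in_itvoo R (x 0 j - k.+1%:R^-1) (x 0 j + k.+1%:R^-1).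
    by rewrite ltrD2l (lt_trans _ k0)// oppr_lt0.
  rewrite in_itv/= => /andP[q1 q2]; exists q.
  by rewrite distrC ltr_distl q1 q2.
pose c := \row_j sval (cid (cP j)).
exists (c, k); split => [j|y ybox]; first by rewrite mxE; case: cid.
rewrite [ltLHS]/Num.Def.normr/= mx_normrE; apply: bigmax_lt => // -[i j] _ /=.
rewrite (ord1 i) !mxE; have := ybox j; rewrite /= mxE; case: cid => q /= qx qy.
rewrite (_ : _ - _ = (y 0 j - ratr q) - (x 0 j - ratr q)); last by ring.
by apply: le_lt_trans (ler_normB _ _) _; rewrite (splitr e) ltrD// (lt_trans _ k2).
Qed.

Lemma rV_open_norm n (U : set 'rV[R]_n) x : open U -> U x ->
  exists2 e, 0 < e & forall y, `|y - x| < e -> U y.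
Proof.
move=> oU Ux; have /nbhs_ballP[e /= e0 eU] : nbhs x U by exact: open_nbhs_nbhs.
exists e => // y yx; apply: eU; rewrite -ball_normE /ball_/=.
by rewrite distrC.
Qed.

Lemma norm_lt_open n (x : 'rV[R]_n) e : open [set y | `|y - x| < e].
Proof.
rewrite openE => y /= yx; apply/nbhs_ballP; exists (e - `|y - x|) => /=.
  by rewrite subr_gt0.
move=> z; rewrite -ball_normE /ball_/= => yz.
rewrite (_ : z - x = (y - x) - (y - z)); last first.
  by apply/rowP => j; rewrite !mxE; ring.
by apply: le_lt_trans (ler_normB _ _) _; rewrite addrC -ltrBrDr.
Qed.

(* The library has no sigma-algebra on row vectors. *)
Definition borel_fun (T : topologicalType) (g : R -> T) : Prop :=
  forall U, open U -> measurable (g @^-1` U).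

Lemma rV_boxE n (i : 'rV[rat]_n * nat) :
  rV_box i = [set x | `|x - map_mx ratr i.1| < i.2.+1%:R^-1].
Proof.
have k0 : 0 < i.2.+1%:R^-1 :> R by rewrite invr_gt0.
apply/seteqP; split => x /= h.
  rewrite [ltLHS]/Num.Def.normr/= mx_normrE; apply: bigmax_lt => // -[u j] _ /=.
  by rewrite (ord1 u) !mxE.
move=> j; apply: le_lt_trans h.
rewrite [leRHS]/Num.Def.normr/= mx_normrE.
apply: le_trans; last exact: (le_bigmax _ _ (0, j)).
by rewrite !mxE.
Qed.

Lemma borel_fun_box n (g : R -> 'rV[R]_n) i :
  borel_fun g -> measurable (g @^-1` rV_box i).
Proof. by move=> bg; apply: bg; rewrite rV_boxE; exact: norm_lt_open. Qed.

Lemma measurable_fun_gt (g : R -> R) :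
  (forall c, measurable [set s | c < g s]) -> measurable_fun setT g.
Proof.
move=> mg; apply: (measurability _ (RGenOInfty.measurableE R)) => /= _ [_ [c ->] <-].
rewrite setTI (_ : _ @^-1` _ = [set s | c < g s]); first exact: mg.
by apply/seteqP; split => s /=; rewrite in_itv/= andbT.
Qed.

Lemma borel_fun_coordP n (g : R -> 'rV[R]_n) :
  borel_fun g <-> forall j, measurable_fun setT (fun s => g s 0 j).
Proof.
split=> [bg j|mg U oU].
  apply: measurable_fun_gt => c.
  apply: (bg [set x | c < x 0 j]).
  apply: (@open_comp _ _ (fun x : 'rV[R]_n => x 0 j) [set y | c < y]); last exact: open_gt.
  by move=> x _; exact: coord_continuous.
have -> : g @^-1` U = \bigcup_i
    (if `[< rV_box i `<=` U >] then g @^-1` rV_box i else set0).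
  apply/seteqP; split => s /=.
    move=> Us; have [e e0 eU] := rV_open_norm oU Us.
    have [i [gi ie]] := rV_box_basis (g s) e0.
    by exists i => //; case: asboolP => // -[] y /ie /eU.
  by move=> [i _]; case: asboolP => // iU /iU.
apply: countable_bigcupT_measurable; [exact: countableP|move=> i].
case: asboolP => // _.
have -> : g @^-1` rV_box i = \bigcap_(j in [set: 'I_n])
    [set s | `|g s 0 j - ratr (i.1 0 j)| < i.2.+1%:R^-1].
  by apply/seteqP; split => s /= h j; [move=> _; exact: h|exact: h j I].
apply: fin_bigcap_measurable => // j _.
have mh : measurable_fun setT (fun s => `|g s 0 j - ratr (i.1 0 j)|).
  by apply: measurableT_comp => //; apply: measurable_funB.
have := mh measurableT `]-oo, i.2.+1%:R^-1[%classic (measurable_itv _).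
by rewrite setTI; congr (measurable _).
Qed.

Lemma borel_fun_cst n (c : 'rV[R]_n) : borel_fun (fun _ : R => c).
Proof. by apply/borel_fun_coordP => j; exact: measurable_cst. Qed.

(** Continuity relative to the product of the whole space with [A] and [B]; nothing is known about
    [f] elsewhere. *)
Definition jointly_continuous n p q m (A : set 'rV[R]_p) (B : set 'rV[R]_q)
    (f : 'rV[R]_n -> 'rV[R]_p -> 'rV[R]_q -> 'rV[R]_m) : Prop :=
  forall (x : 'rV[R]_n) (a : 'rV[R]_p) (b : 'rV[R]_q), A a -> B b ->
  forall e : R, 0 < e -> exists2 d : R, 0 < d &
     forall (x' : 'rV[R]_n) (a' : 'rV[R]_p) (b' : 'rV[R]_q), A a' -> B b' ->
       `|x' - x| < d -> `|a' - a| < d -> `|b' - b| < d ->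
       `|f x' a' b' - f x a b| < e.

(** The preimage of [U] is the union over those triples of boxes whose points with controls in [A]
    and [B] are all sent into [U] by [f]; there are countably many triples. *)
Lemma borel_fun_comp3 n p q m (A : set 'rV[R]_p) (B : set 'rV[R]_q)
    (f : 'rV[R]_n -> 'rV[R]_p -> 'rV[R]_q -> 'rV[R]_m) x a b :
  jointly_continuous A B f ->
  borel_fun x -> borel_fun a -> borel_fun b ->
  (forall s, A (a s)) -> (forall s, B (b s)) ->
  borel_fun (fun s => f (x s) (a s) (b s)).
Proof.
move=> fc bx ba bb Aa Bb U oU.
pose good i := forall y c d, A c -> B d -> rV_box i.1.1 y -> rV_box i.1.2 c ->
  rV_box i.2 d -> U (f y c d).
have -> : (fun s => f (x s) (a s) (b s)) @^-1` U = \bigcup_i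
    (if `[< good i >] then
       x @^-1` rV_box i.1.1 `&` a @^-1` rV_box i.1.2 `&` b @^-1` rV_box i.2
     else set0).
  apply/seteqP; split => s /=.
    move=> Us; have [e e0 eU] := rV_open_norm oU Us.
    have [d d0 hd] := fc (x s) (a s) (b s) (Aa s) (Bb s) e e0.
    have [i [xi ie]] := rV_box_basis (x s) d0.
    have [j [aj je]] := rV_box_basis (a s) d0.
    have [k [bk ke]] := rV_box_basis (b s) d0.
    exists (i, j, k) => //; case: asboolP => [_|[]]; first by split.
    by move=> y c d' Ac Bd /= /ie yi /je cj /ke dk; apply: eU; exact: hd.
  by move=> [i _]; case: asboolP => // + [[? ?] ?]; apply.
apply: countable_bigcupT_measurable; [exact: countableP|move=> i].
case: asboolP => // _.
by apply: measurableI; [apply: measurableI|]; exact: borel_fun_box.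
Qed.

(** One point of [B] is picked in each rational box that meets [B]; the other boxes receive the
    default [b0]. *)
Lemma dense_family n (B : set 'rV[R]_n) : B !=set0 ->
  exists D : 'rV[rat]_n * nat -> 'rV[R]_n, (forall i, B (D i)) /\
    forall b e, B b -> 0 < e -> exists i, `|D i - b| < e.
Proof.
move=> [b0 Bb0]; exists (fun i => if pselect (exists b, B b /\ rV_box i b) is left h
  then sval (cid h) else b0); split.
  by move=> i; case: pselect => // h; case: cid => b [].
move=> b e Bb e0; have [i [bi ie]] := rV_box_basis b e0.
exists i; case: pselect => [h|[]]; last by exists b.
by case: cid => c /= [_ /ie].
Qed.

(** Only the preimages of the countably many boxes need Borel versions, so the exceptional sets have
    a null union [M]. Off [[t, 0]] and on [M] the signal is replaced by its value at [t], which
    keeps all values in [A]. *)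
Lemma signal_borel n (t : R) (A : set 'rV[R]_n) a : t < 0 -> signals t A a ->
  exists a' : R -> 'rV[R]_n, [/\ borel_fun a', forall s, A (a' s) &
    {ae mu, forall s, s \in `[t, 0] -> a' s = a s}].
Proof.
move=> t0 [Aa ma].
have mbox i : lebesgue_measurable (`[t, 0] `&` a @^-1` rV_box i).
  by apply: ma; rewrite rV_boxE; exact: norm_lt_open.
have {}mbox i : exists EM : set R * set R, [/\ measurable EM.1, measurable EM.2,
    mu EM.2 = 0 & (`[t, 0] `&` a @^-1` rV_box i) `\` EM.2 = EM.1 `\` EM.2].
  have [E mE [N [M [mM M0 NM]] EN]] := mbox i.
  exists (E, M); split => //=; rewrite -EN.
  by apply/seteqP; split=> s /= [h nM]; split => //; [case: h => // /NM|left].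
pose EM i := sval (cid (mbox i)).
pose M := \bigcup_i (EM i).2.
have mM : measurable M.
  apply: countable_bigcupT_measurable; [exact: countableP|move=> i].
  by rewrite /EM; case: cid => ? [].
have M0 : mu.-negligible M.
  have -> : M = \bigcup_k (if unpickle k is Some i then (EM i).2 else set0).
    apply/seteqP; split => s.
      by move=> [i _ si]; exists (pickle i) => //; rewrite pickleK.
    by move=> [k _]; case: unpickle => // i si; exists i.
  apply: negligible_bigcup => k; case: unpickle => [i|]; last exact: negligible_set0.
  rewrite /EM; case: cid => EM' /= [_ mM' M'0 _].
  by exists EM'.2; split.
have At : A (a t) by apply: Aa; rewrite in_itv/= lexx ltW.
pose G := `[t, 0]%classic `\` M.
have mG : measurable G by apply: measurableD => //; exact: measurable_itv.
exists (fun s => if `[< G s >] then a s else a t); split.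
- move=> U oU.
  have -> : (fun s => if `[< G s >] then a s else a t) @^-1` U =
     (\bigcup_i (if `[< rV_box i `<=` U >] then (EM i).1 `\` M else set0)) `|`
     (if `[< U (a t) >] then ~` G else set0).
    have EMi i s : ~ M s -> (`[t, 0]%classic s /\ rV_box i (a s)) <-> (EM i).1 s.
      move=> nMs; have nMi : ~ (EM i).2 s by move=> h; apply: nMs; exists i.
      move: nMi; rewrite /EM; case: cid => EM' /= [_ _ _ /seteqP[h1 h2]] nMi.
      by split=> [h|h]; [case: (h1 s)|case: (h2 s)].
    apply/seteqP; split => s /=.
      case: asboolP => [[st nMs] Us|nG Us]; last by right; case: asboolP.
      left; have [e e0 eU] := rV_open_norm oU Us.
      have [i [gi ie]] := rV_box_basis (a s) e0.
      exists i => //; case: asboolP => [_|[]]; last by move=> y /ie /eU.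
      by split => //; apply/EMi.
    case=> [[i _]|].
      case: asboolP => // iU [Es nMs].
      have [st si] := (EMi i s nMs).2 Es.
      by case: asboolP => [_|[]//]; apply: iU.
    by case: asboolP => // Ut nGs; case: asboolP.
  apply: measurableU; last by case: asboolP => // _; exact: measurableC.
  apply: countable_bigcupT_measurable; [exact: countableP|move=> i].
  case: asboolP => // _; apply: measurableD => //.
  by rewrite /EM; case: cid => ? [].
- by move=> s; case: asboolP => // -[st _]; exact: Aa.
- apply: negligibleS M0 => s /=; apply: contra_notP => nMs st.
  by case: asboolP => // -[].
Qed.

(** Converse of [signal_borel]: a change on a null set stays within the completed sigma-algebra. *)
Lemma borel_signal n (t : R) (B : set 'rV[R]_n) b b' :
  (forall s, s \in `[t, 0] -> B (b s)) -> borel_fun b' ->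
  {ae mu, forall s, s \in `[t, 0] -> b' s = b s} -> signals t B b.
Proof.
move=> Bb bb' [N [mN N0 NP]]; split => // U oU.
exists ((`[t, 0] `&` b' @^-1` U) `\` N).
  apply: measurableD => //; apply: measurableI; [exact: measurable_itv|exact: bb'].
exists ((`[t, 0] `&` b @^-1` U) `&` N); first by exists N; split.
have bN s : ~ N s -> `[t, 0]%classic s -> b' s = b s.
  by move=> nNs st; apply: contrapT => h; apply/nNs/NP => /=; move=> /(_ st).
apply/seteqP; split => s /=.
  by case=> [[[st Us] nNs]|[]//]; split => //; rewrite -bN.
move=> [st Us]; have [Ns|nNs] := pselect (N s); first by right.
by left; split => //; split => //=; rewrite bN.
Qed.

End Borel.

(** * Caratheodory differential equations *)

Section ODE.
Context {R : realType}.
Notation mu := (@lebesgue_measure R).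

Lemma abs_cont_le (u v M : R) psi : u <= v -> abs_cont u v psi ->
  {ae mu, forall s, s \in `[u, v] -> exists2 d, d <= M & is_derive s 1 psi d} ->
  psi v - psi u <= M * (v - u).
Proof.
move=> uv acpsi aepsi.
have := @ae_derive_le0_le R u v (fun s => psi s + - M * s) uv.
have acM : abs_cont u v (fun s => - M * s).
  apply: abs_contZ; apply: (@abs_cont_lipschitz _ _ _ 1) => x y _ xy _.
  by rewrite mul1r ger0_norm ?subr_ge0.
move=> /(_ (abs_contD acpsi acM)) H; suff : psi v + - M * v <= psi u + - M * u by lra.
apply: H; apply: ae_imply aepsi => s h /h[d dM dpsi]; exists (d - M); first by rewrite subr_le0.
apply/is_derive_epsP => e e0; have [r r0 rP] := (is_derive_epsP _ _ _).1 dpsi _ e0.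
exists r => // y /rP.
rewrite (_ : psi y + - M * y - (psi s + - M * s) - (d - M) * (y - s) =
  psi y - psi s - d * (y - s))//.
by ring.
Qed.

Lemma abs_cont_norm_le n (u v M : R) (x : R -> 'rV[R]_n) : u <= v -> 0 <= M ->
  (forall j, abs_cont u v (fun s => x s 0 j)) ->
  {ae mu, forall s, s \in `[u, v] -> exists2 d, is_derive s 1 x d & `|d| <= M} ->
  `|x v - x u| <= M * (v - u).
Proof.
move=> uv M0 acx aex; apply/rV_norm_leP; first by rewrite mulr_ge0 ?subr_ge0.
move=> j; rewrite !mxE ler_norml.
have h1 : x v 0 j - x u 0 j <= M * (v - u).
  apply: (@abs_cont_le u v M (fun s => x s 0 j)) => //.
  apply: ae_imply aex => s h /h[d dx dM]; exists (d 0 j); last exact: (is_derive_coordP _ _ _).1.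
  by rewrite (le_trans (ler_norm _))// (le_trans (coord_le_norm _ _)).
have h2 : -1 * x v 0 j - -1 * x u 0 j <= M * (v - u).
  apply: (@abs_cont_le u v M (fun s => -1 * x s 0 j)) => //; first exact: abs_contZ.
  apply: ae_imply aex => s h /h[d dx dM]; exists (-1 * d 0 j).
    rewrite mulN1r lerNl (le_trans _ (lerNnormlW (le_trans (coord_le_norm _ _) dM)))//.
  exact: (is_deriveZ (-1) ((is_derive_coordP _ _ _).1 dx j)).
by apply/andP; split; lra.
Qed.

Lemma is_deriveB_rV n (x y : R -> 'rV[R]_n) (s : R) dx dy :
  is_derive s 1 x dx -> is_derive s 1 y dy ->
  is_derive s 1 (fun r => x r - y r) (dx - dy).
Proof. by move=> hx hy; exact: is_deriveB. Qed.

Lemma abs_contB_coord n (u v : R) (x y : R -> 'rV[R]_n) :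
  (forall j, abs_cont u v (fun s => x s 0 j)) ->
  (forall j, abs_cont u v (fun s => y s 0 j)) ->
  forall j, abs_cont u v (fun s => (x s - y s) 0 j).
Proof.
move=> hx hy j; rewrite (_ : (fun s => _) = (fun s => x s 0 j + -1 * y s 0 j)).
  by apply: abs_contD => //; exact: abs_contZ.
by apply/funext => s; rewrite !mxE mulN1r.
Qed.

Lemma abs_cont_cst (u v c : R) : abs_cont u v (fun=> c).
Proof.
by apply: (@abs_cont_lipschitz _ _ _ 0) => x y _ _ _; rewrite subrr normr0 mul0r.
Qed.

Lemma linear_growth_bound n (t v K : R) x0 (x : R -> 'rV[R]_n) :
  0 < K -> absolutely_continuous t v x -> x t = x0 ->
  {ae mu, forall s, s \in `[t, v] ->
     exists2 d, is_derive s 1 x d & `|d| <= K * (`|x s| + 1)} ->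
  forall s, s \in `[t, v] -> `|x s| <= `|x0| + (`|x0| + 1) * gauge K t s.
Proof.
move=> K0 acx xt aex s stv.
have [C C0 xC] := within_continuous_bounded (absolutely_continuous_within acx).
have acD : forall j, abs_cont t v (fun s => (x s - x0) 0 j).
  apply: (abs_contB_coord (y := fun=> x0)); first by move=> j; exact: abs_cont_coord.
  by move=> j; exact: abs_cont_cst.
rewrite -[x s](subrK x0) addrC; apply: le_trans (ler_normD _ _) _; rewrite lerD2l.
(* The constant comes from [|x| + 1 <= |x - x0| + (|x0| + 1)]. *)
apply: (@gronwall _ _ (fun s => x s - x0) K (`|x0| + 1) (C + `|x0|) t v) => //.
- by rewrite addr_ge0.
- by rewrite xt subrr.
- by move=> r /xC h; apply: le_trans (ler_normB _ _) _; rewrite lerD2r.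
apply: ae_imply aex => r h /h[d dx dK]; exists d.
  by rewrite -[d]subr0; apply: is_deriveB_rV => //; exact: is_derive_cst.
apply: le_trans dK _; rewrite ler_wpM2l ?(ltW K0)// addrA lerD2r -lerBlDr.
exact: lerB_dist.
Qed.

Lemma abs_cont_coord_sub n (u v u' v' : R) (x : R -> 'rV[R]_n) : u <= u' -> v' <= v ->
  absolutely_continuous u v x -> forall j, abs_cont u' v' (fun s => x s 0 j).
Proof. by move=> h1 h2 acx j; apply: abs_cont_sub h1 h2 _; exact: abs_cont_coord. Qed.

(** Gronwall with [c = 0]; the bound [C] confines both functions to a ball on which [g] is
    Lipschitz. *)
Lemma carath_unique n (u v L : R) (g : R -> 'rV[R]_n -> 'rV[R]_n)
    (x y : R -> 'rV[R]_n) (C : R) :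
  0 < L -> 0 <= C ->
  (forall j, abs_cont u v (fun s => x s 0 j)) ->
  (forall j, abs_cont u v (fun s => y s 0 j)) -> x u = y u ->
  (forall s, s \in `[u, v] -> `|x s| <= C) ->
  (forall s, s \in `[u, v] -> `|y s| <= C) ->
  (forall s (z z' : 'rV[R]_n), s \in `[u, v] -> `|z| <= C -> `|z'| <= C ->
    `|g s z - g s z'| <= L * `|z - z'|) ->
  {ae mu, forall s, s \in `[u, v] -> is_derive s 1 x (g s (x s))} ->
  {ae mu, forall s, s \in `[u, v] -> is_derive s 1 y (g s (y s))} ->
  forall s, s \in `[u, v] -> x s = y s.
Proof.
move=> L0 C0 acx acy xy xC yC gL dx dy s suv.
have : `|x s - y s| <= 0 * gauge L u s.
  apply: (@gronwall _ _ (fun s => x s - y s) L 0 (C + C) u v) => //.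
  - by rewrite addr_ge0.
  - exact: abs_contB_coord.
  - by rewrite xy subrr.
  - by move=> r ruv; apply: le_trans (ler_normB _ _) _; rewrite lerD ?xC ?yC.
  apply: ae_imply (ae_conj dx dy) => r [dxr dyr] ruv.
  exists (g r (x r) - g r (y r)); first by apply: is_deriveB_rV; [exact: dxr|exact: dyr].
  by rewrite addr0 gL ?xC ?yC.
by rewrite mul0r normr_le0 subr_eq0 => /eqP.
Qed.

Lemma lipschitz_borel n (x : R -> 'rV[R]_n) M :
  (forall s r, `|x s - x r| <= M * `|s - r|) -> borel_fun x.
Proof.
move=> lip U oU; apply: open_measurable; apply: open_comp => // s _.
apply/cvgrPdist_lt => e e0.
have M0 : 0 < `|M| + 1 by rewrite ltr_wpDl.
have := nbhsx_ballx s _ (divr_gt0 e0 M0); apply: filterS => r; rewrite /ball/= => sr.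
apply: le_lt_trans (lip _ _) _; apply: (@le_lt_trans _ _ ((`|M| + 1) * `|s - r|)).
  by rewrite ler_wpM2r// (le_trans (ler_norm M))// lerDl.
by rewrite mulrC -ltr_pdivlMr.
Qed.

Lemma lipschitz_primitive_rV n (g : R -> 'rV[R]_n) (M t : R) x0 :
  t < 0 -> borel_fun g -> (forall s, `|g s| <= M) ->
  exists Y : R -> 'rV[R]_n, [/\ Y t = x0,
    forall s r, `|Y s - Y r| <= M * `|s - r| &
    {ae mu, forall s, s \in `[t, 0] -> is_derive s 1 Y (g s)}].
Proof.
move=> t0 /borel_fun_coordP bg gM.
have M0 : 0 <= M := le_trans (normr_ge0 _) (gM 0).
have /choice[G GP] j : exists G : R -> R, [/\ G t = 0,
    forall x y, `|G x - G y| <= M * `|x - y| &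
    {ae mu, forall s, s \in `[t, 0] -> is_derive s 1 G (g s 0 j)}].
  apply: (lipschitz_primitive t0 (bg j)) => s.
  exact: le_trans (coord_le_norm _ _) (gM s).
exists (fun s => \row_j (G j s + x0 0 j)); split.
- by apply/rowP => j; have [Gt _ _] := GP j; rewrite mxE Gt add0r.
- move=> s r; apply/rV_norm_leP; first by rewrite mulr_ge0.
  move=> j; have [_ GM _] := GP j; rewrite !mxE.
  by rewrite opprD addrACA subrr addr0.
have : {ae mu, forall s, forall j, s \in `[t, 0] -> is_derive s 1 (G j) (g s 0 j)}.
  by apply: ae_forall_countable => j; have [] := GP j.
apply: ae_imply => s h st; apply/is_derive_coordP => j.
rewrite (_ : (fun r => _) = (fun r => G j r - - x0 0 j)); last first.
  by apply/funext => r; rewrite mxE opprK.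
apply/is_derive_epsP => e e0; have [r r0 rP] := (is_derive_epsP _ _ _).1 (h j st) _ e0.
exists r => // y /rP; rewrite (_ : G j y - - x0 0 j - (G j s - - x0 0 j) = G j y - G j s)//.
by ring.
Qed.

End ODE.

(** * Uniform limits along an ultrafilter *)

Section Ultralimit.
Context {R : realType}.

(** Compactness of closed balls gives pointwise limits. A filter is closed under finite
    intersections only, so closeness is obtained on a finite grid and carried to all of [[t, 0]] by
    the common Lipschitz constant. *)
Lemma ultra_uniform_limit n (U : set_system nat) (X : nat -> R -> 'rV[R]_n) (M t : R) x0 :
  UltraFilter U -> t < 0 -> (forall k, X k t = x0) ->
  (forall k s r, `|X k s - X k r| <= M * `|s - r|) ->
  exists Y : R -> 'rV[R]_n, [/\ Y t = x0,
    (forall s r, `|Y s - Y r| <= M * `|s - r|) &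
    (forall e, 0 < e -> U [set k | forall s, s \in `[t, 0] -> `|X k s - Y s| <= e])].
Proof.
move=> UU t0 Xt XM.
have Yex s : exists y, forall e, 0 < e -> U [set k | `|X k s - y| < e].
  have : compact [set y : 'rV[R]_n | `|y| <= `|x0| + M * `|s - t|].
    apply: bounded_closed_compact.
      exists (`|x0| + M * `|s - t|); split; first exact: num_real.
      by move=> z zM y /= h; exact: le_trans h (ltW zM).
    apply: (@closed_comp _ _ (fun y : 'rV[R]_n => `|y|)
      [set z | z <= `|x0| + M * `|s - t|]); last exact: closed_le.
    by move=> y _; exact: norm_continuous.
  move=> /(_ ((X ^~ s) @ U) _)[].
    suff : U [set k | `|X k s| <= `|x0| + M * `|s - t|] by [].
    apply: filterS filterT => k _ /=.
    rewrite -[X k s](subrK x0) addrC.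
    by apply: le_trans (ler_normD _ _) _; rewrite lerD2l -{1}(Xt k).
  (* A cluster point of an ultrafilter is a limit: if a ball around [y] is not a member, its
     complement is, and that complement misses the ball. *)
  move=> y [_ clu]; exists y => e e0.
  have [//|nU] := in_ultra_setVsetC [set k | `|X k s - y| < e] UU.
  have [|z [/= nze]] := clu [set z | ~ `|z - y| < e] (ball y e) _ (nbhsx_ballx y e e0).
    exact: nU.
  by rewrite -ball_normE /ball_/= distrC => /nze.
pose Y s := sval (cid (Yex s)).
have YP s e : 0 < e -> U [set k | `|X k s - Y s| < e].
  by move=> e0; rewrite /Y; case: cid => y /= /(_ _ e0).
have YM s r : `|Y s - Y r| <= M * `|s - r|.
  apply/ler_addgt0Pr => e e0; have e2 : 0 < e / 2 by rewrite divr_gt0.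
  have [k [/= ks kr]] := filter_ex (filterI (YP s _ e2) (YP r _ e2)).
  rewrite (_ : Y s - Y r = (X k s - X k r) + ((X k r - Y r) - (X k s - Y s))); last first.
    by apply/rowP => j; rewrite !mxE; ring.
  apply: le_trans (ler_normD _ _) _; rewrite lerD// (splitr e).
  by apply: le_trans (ler_normB _ _) _; exact: lerD (ltW kr) (ltW ks).
exists Y; split => //.
  apply/eqP; rewrite -subr_eq0 -normr_le0; apply/ler_addgt0Pr => e e0.
  have [k /= kt] := filter_ex (YP t _ e0).
  by rewrite -(Xt k) distrC add0r ltW.
move=> e e0; have M0 : 0 < `|M| + 1 by rewrite ltr_wpDl.
(* With this mesh, moving to the nearest lower grid point costs at most [e / 3] for [X k] and for
   [Y]; the third part is for the grid point itself. *)
pose d := e / 3 / (`|M| + 1); have d0 : 0 < d by rewrite !divr_gt0.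
pose N := Num.bound (- t / d).
pose g i := t + d * i%:R.
have e3 : 0 < e / 3 by rewrite divr_gt0.
have : U [set k | forall i : 'I_N.+1, `|X k (g i) - Y (g i)| < e / 3].
  by apply: filter_forall => i; exact: YP.
apply: filterS => k /= kg s; rewrite in_itv/= => /andP[ts s0].
pose i := Num.truncn ((s - t) / d).
have st0 : 0 <= (s - t) / d by rewrite divr_ge0 ?subr_ge0// ltW.
have /andP[i1 i2] := truncn_itv st0; rewrite -/i in i1 i2.
have iN : (i < N.+1)%N.
  rewrite ltnS -(ler_nat R) ltW// (le_lt_trans i1)//.
  apply: (@le_lt_trans _ _ (- t / d)); last first.
    by rewrite archi_boundP// divr_ge0 ?oppr_ge0 ?ltW.
  by rewrite ler_pM2r ?invr_gt0//; lra.
have sg : `|s - g i| <= d.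
  move: i1 i2; rewrite ler_pdivlMr// ltr_pdivrMr// => i1 i2.
  rewrite /g ger0_norm.
    by move: i2; rewrite -natr1; lra.
  by lra.
have Md : M * `|s - g i| <= e / 3.
  apply: (@le_trans _ _ ((`|M| + 1) * d)); last by rewrite mulrC divfK// gt_eqF.
  apply: (@le_trans _ _ ((`|M| + 1) * `|s - g i|)); last by rewrite ler_pM2l.
  by rewrite ler_wpM2r// (le_trans (ler_norm M))// lerDl.
rewrite (_ : X k s - Y s =
  (X k s - X k (g i)) + ((X k (g i) - Y (g i)) - (Y s - Y (g i)))); last first.
  by apply/rowP => j; rewrite !mxE; ring.
rewrite (_ : e = e / 3 + (e / 3 + e / 3)); last by field.
apply: le_trans (ler_normD _ _) _; apply: lerD; first exact: le_trans (XM _ _ _) Md.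
apply: le_trans (ler_normB _ _) _; apply: lerD; last exact: le_trans (YM _ _) Md.
exact: ltW (kg (Ordinal iN)).
Qed.

End Ultralimit.

(** * Measurable selection *)

Section Selection.
Context {R : realType} {q : nat}.
Variable B : set 'rV[R]_q.
Hypotheses (B0 : B !=set0) (cB : compact B).

Definition continuous_on n (C : set 'rV[R]_n) (g : 'rV[R]_n -> R) :=
  forall b, C b -> forall e, 0 < e -> exists2 d, 0 < d &
    forall b', C b' -> `|b' - b| < d -> `|g b' - g b| < e.

Lemma continuous_on_within n (C : set 'rV[R]_n) g :
  continuous_on C g -> {within C, continuous g}.
Proof.
move=> cg; apply/subspace_continuousP => b Cb; apply/cvgrPdist_lt => e e0.
have [d d0 hd] := cg b Cb e e0.
have := nbhsx_ballx b d d0; rewrite near_withinE; apply: filterS => b'.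
rewrite -ball_normE /ball_/= => bb' Cb'; rewrite distrC; apply: hd => //.
by rewrite distrC.
Qed.

Lemma continuous_on_coord n (C : set 'rV[R]_n) j c : continuous_on C (fun b => b 0 j - c).
Proof.
move=> b Cb e e0; exists e => // b' _; apply: le_lt_trans.
rewrite opprB addrA subrK [leRHS]/Num.Def.normr/= mx_normrE.
apply: le_trans; last exact: (le_bigmax _ _ (0, j)).
by rewrite !mxE.
Qed.

Lemma continuous_on_norm n (C : set 'rV[R]_n) g : continuous_on C g ->
  continuous_on C (fun b => `|g b|).
Proof.
move=> cg b Cb e e0; have [d d0 hd] := cg b Cb e e0; exists d => // b' Cb' /(hd _ Cb').
by apply: le_lt_trans; exact: ler_dist_dist.
Qed.

Lemma continuous_onD n (C : set 'rV[R]_n) g h : continuous_on C g ->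
  continuous_on C h -> continuous_on C (fun b => g b + h b).
Proof.
move=> cg ch b Cb e e0; have e2 : 0 < e / 2 by rewrite divr_gt0.
have [d1 d10 hd1] := cg b Cb _ e2; have [d2 d20 hd2] := ch b Cb _ e2.
exists (Num.min d1 d2); first by rewrite lt_min d10.
move=> b' Cb'; rewrite lt_min => /andP[/(hd1 _ Cb') h1 /(hd2 _ Cb') h2].
by rewrite opprD addrACA (splitr e) (le_lt_trans (ler_normD _ _))// ltrD.
Qed.

(** Minimizing the maximum of [psi b] and [b 0 j - c] over [B] meets both constraints at once: the
    minimum is below every positive [e]. *)
Lemma compact_approx_zero j c (psi : 'rV[R]_q -> R) :
  continuous_on B psi -> (forall b, B b -> 0 <= psi b) ->
  (forall e, 0 < e -> exists b, [/\ B b, b 0 j < c + e & psi b < e]) ->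
  exists b, [/\ B b, b 0 j <= c & psi b = 0].
Proof.
move=> cpsi psi0 happ.
pose g b := Num.max (psi b) (b 0 j - c).
have cg : {within B, continuous g}.
  apply: continuous_on_within => b Bb e e0.
  have [d1 d10 hd1] := cpsi b Bb e e0.
  have [d2 d20 hd2] := continuous_on_coord j c Bb e0.
  exists (Num.min d1 d2); first by rewrite lt_min d10.
  move=> b' Bb'; rewrite lt_min => /andP[/(hd1 _ Bb') + /(hd2 _ Bb')].
  rewrite !ltr_distl /g => /andP[h1 h2] /andP[h3 h4].
  by case: (leP (psi b)) => ?; case: (leP (psi b')) => ?; apply/andP; split; lra.
have [b /set_mem Bb bmin] := EVT_min_rV B0 cB cg.
have gb : g b <= 0.
  apply/ler_addgt0Pr => e e0; rewrite add0r.
  have [b' [Bb' b'j b'psi]] := happ e e0.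
  apply: le_trans (bmin b' (mem_set Bb')) _.
  by rewrite ge_max (ltW b'psi) lerBlDl ltW.
move: gb; rewrite ge_max => /andP[h1 h2]; exists b; split => //.
  by rewrite -subr_le0.
by apply/eqP; rewrite eq_le h1 psi0.
Qed.

(** Caratheodory integrands; their zero sets encode set-valued maps with nonempty compact values in
    [B]. The equation for the control will appear as the vanishing of a norm. *)
Record carath (Phi : R -> 'rV[R]_q -> R) : Prop := Carath {
  carath_meas : forall b, B b -> measurable_fun setT (Phi^~ b);
  carath_cont : forall s, continuous_on B (Phi s);
  carath_ge0 : forall s b, B b -> 0 <= Phi s b;
  carath_zero : forall s, exists2 b, B b & Phi s b = 0 }.

Definition zeros (Phi : R -> 'rV[R]_q -> R) (s : R) : set 'rV[R]_q :=
  [set b | B b /\ Phi s b = 0].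

Definition coord_min (j : 'I_q) (Z : set 'rV[R]_q) : set 'rV[R]_q :=
  [set b | Z b /\ forall b', Z b' -> b 0 j <= b' 0 j].

(** The least coordinate is at most [c] exactly when, for each [k], some member of a dense family is
    a zero up to [1/(k+1)] with coordinate below [c + 1/(k+1)]; compactness turns such approximate
    zeros into an exact one. *)
Lemma coord_min_measurable (Phi : R -> 'rV[R]_q -> R) j : carath Phi ->
  exists m : R -> R, [/\ measurable_fun setT m,
    forall s, exists2 b, zeros Phi s b & b 0 j = m s &
    forall s b, zeros Phi s b -> m s <= b 0 j].
Proof.
move=> [mP cP P0 zP].
have [D [BD dD]] := dense_family B0.
have [b1 _ bmin] := EVT_min_rV B0 cB (continuous_on_within (@continuous_on_coord _ B j 0)).
pose V s := [set b 0 j | b in zeros Phi s].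
have Vinf s : has_inf (V s).
  split; first by have [b Bb bz] := zP s; exists (b 0 j); exists b.
  exists (b1 0 j) => _ [b [Bb _] <-].
  by have := bmin b (mem_set Bb); rewrite !subr0.
pose m s := inf (V s).
have mle s b : zeros Phi s b -> m s <= b 0 j.
  by move=> zb; apply: ge_inf; [exact: (Vinf s).2|exists b].
have matt s : exists2 b, zeros Phi s b & b 0 j = m s.
  have [|b [Bb bj bz]] := @compact_approx_zero j (m s) (Phi s) (cP s) (P0 s).
    move=> e e0; have [_ [b [Bb bz] <-] be] := inf_adherent e0 (Vinf s).
    by exists b; rewrite bz.
  by exists b => //; apply/eqP; rewrite eq_le bj mle.
exists m; split => //; apply: measurable_fun_gt => c.
rewrite (_ : mkset _ = ~` \bigcap_k \bigcup_i
    (if D i 0 j < c + k.+1%:R^-1 then [set s | Phi s (D i) < k.+1%:R^-1] else set0)).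
  apply: measurableC; apply: bigcapT_measurable => k.
  apply: countable_bigcupT_measurable; [exact: countableP|move=> i].
  case: ifPn => // _.
  have := mP (D i) (BD i) measurableT `]-oo, k.+1%:R^-1[%classic (measurable_itv _).
  by rewrite setTI; congr (measurable _).
rewrite -[LHS]setCK; congr (~` _); apply/seteqP; split => s /=.
  move=> /negP; rewrite -leNgt => msc k _.
  have [b [Bb bz] bm] := matt s.
  have k0 : 0 < k.+1%:R^-1 :> R by rewrite invr_gt0.
  have [d1 d10 hd1] := cP s b Bb _ k0.
  have [d2 d20 hd2] := @continuous_on_coord _ B j 0 b Bb _ k0.
  have d120 : 0 < Num.min d1 d2 by rewrite lt_min d10.
  have [i] := dD b _ Bb d120; rewrite lt_min => /andP[/(hd1 _ (BD i)) + /(hd2 _ (BD i))].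
  rewrite bz !subr0 => h1 h2; exists i => //.
  move: h2; rewrite ltr_distl bm => /andP[_ h2].
  rewrite ifT; last by apply: lt_le_trans h2 _; rewrite lerD2r.
  by move: h1; rewrite ltr_norml => /andP[].
move=> h; apply/negP; rewrite -leNgt.
have [|b [Bb bj bz]] := @compact_approx_zero j c (Phi s) (cP s) (P0 s).
  move=> e e0; pose k := Num.bound e^-1.
  have ke : k.+1%:R^-1 < e.
    rewrite -[ltRHS]invrK ltf_pV2 ?posrE ?invr_gt0//.
    by rewrite (lt_trans (archi_boundP _)) ?ltr_nat// invr_ge0 ltW.
  have [i _] := h k I; case: ifPn => // Dij /= Phik.
  exists (D i); split => //; last exact: lt_trans ke.
  by apply: lt_trans Dij _; rewrite ltrD2l.
by apply: le_trans bj; apply: mle.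
Qed.

(* Adding [`|b 0 j - m s|], with [m s] the least [j]-th coordinate of a zero, cuts the
   zero set down to the minimizers of that coordinate and keeps the hypotheses. *)
Lemma coord_min_carath (Phi : R -> 'rV[R]_q -> R) j : carath Phi ->
  exists Psi m, [/\ carath Psi, measurable_fun setT m,
    forall s, zeros Psi s = coord_min j (zeros Phi s) &
    forall s b, zeros Psi s b -> b 0 j = m s].
Proof.
move=> cPhi; have [m [mm matt mle]] := coord_min_measurable j cPhi.
case: cPhi => mP cP P0 zP.
pose Psi s (b : 'rV[R]_q) := Phi s b + `|b 0 j - m s|.
have Psi0 s b : B b -> Psi s b = 0 <-> Phi s b = 0 /\ b 0 j = m s.
  move=> Bb; split.
    move/eqP; rewrite /Psi paddr_eq0 ?P0// normr_eq0 subr_eq0.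
    by move=> /andP[/eqP-> /eqP->].
  by rewrite /Psi => -[-> ->]; rewrite subrr normr0 addr0.
exists Psi, m; split => //.
- split=> [b Bb|s|s b Bb|s].
  + apply: measurable_funD; first exact: mP.
    by apply: measurableT_comp => //; apply: measurable_funB.
  + apply: continuous_onD => //; apply: continuous_on_norm; exact: continuous_on_coord.
  + by rewrite addr_ge0// P0.
  + by have [b [Bb bz] bm] := matt s; exists b => //; apply/Psi0.
- move=> s; apply/seteqP; split => b.
    move=> [Bb /(Psi0 _ _ Bb)[bz bm]]; split => // b' /mle; by rewrite bm.
  move=> [[Bb bz] bmin]; split => //; apply/Psi0 => //; split => //.
  have [b' zb' bm'] := matt s; apply/eqP; rewrite eq_le mle// andbT.
  by rewrite -bm' bmin.
- by move=> s b [Bb /(Psi0 _ _ Bb)[]].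
Qed.

Definition lex_min (l : seq 'I_q) (Z : set 'rV[R]_q) := foldl (fun Z j => coord_min j Z) Z l.

Lemma lex_min_sub l Z : lex_min l Z `<=` Z.
Proof.
elim: l Z => [|i l IH] Z; first exact: subset_refl.
by move=> b /IH[].
Qed.

(** After the cut by a coordinate, that coordinate is a measurable function of time on the remaining
    zeros; later cuts only shrink the zero set and preserve this. *)
Lemma lex_min_carath l (Phi : R -> 'rV[R]_q -> R) : carath Phi ->
  exists Psi, [/\ carath Psi,
    forall s, zeros Psi s = lex_min l (zeros Phi s) &
    forall j, j \in l -> exists2 m, measurable_fun setT m &
      forall s b, zeros Psi s b -> b 0 j = m s].
Proof.
elim: l Phi => [|j l IH] Phi cPhi; first by exists Phi.
have [Psi1 [m [cPsi1 mm zPsi1 Psi1m]]] := coord_min_carath j cPhi.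
have [Psi [cPsi zPsi Psim]] := IH _ cPsi1.
have sub Z := @lex_min_sub l Z.
exists Psi; split => //.
  by move=> s; rewrite zPsi zPsi1.
move=> i; rewrite inE => /predU1P[->|/Psim//].
by exists m => // s b; rewrite zPsi => /sub; exact: Psi1m.
Qed.

(** A function of the set [Z] alone, so equal sets give equal points. Once all coordinates are
    minimized at most one point is left; [b0] is the value if there is none. *)
Definition selector (b0 : 'rV[R]_q) (Z : set 'rV[R]_q) := xget b0 (lex_min (enum 'I_q) Z).

Lemma selectorP b0 (Phi : R -> 'rV[R]_q -> R) : carath Phi ->
  borel_fun (fun s => selector b0 (zeros Phi s)) /\
  forall s, zeros Phi s (selector b0 (zeros Phi s)).
Proof.
move=> cPhi; have [Psi [cPsi zPsi Psim]] := lex_min_carath (enum 'I_q) cPhi.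
have selP s : zeros Psi s (selector b0 (zeros Phi s)).
  rewrite /selector -zPsi; apply: xgetPex.
  by have [b Bb bz] := carath_zero cPsi s; exists b.
split; last first.
  by move=> s; have := selP s; rewrite zPsi => /lex_min_sub.
apply/borel_fun_coordP => j.
have [|m mm mP] := Psim j; first by rewrite mem_enum.
rewrite (_ : (fun s => _) = m)//; apply/funext => s; exact: mP (selP s).
Qed.

End Selection.

(** * Existence, bounds and uniqueness of trajectories *)

Section Clamp.
Context {R : realType} {n : nat}.
Variable r : R.
Hypothesis r0 : 0 <= r.

(** For the maximum norm, a 1-Lipschitz retraction onto the closed ball of radius [r]; it makes a
    locally Lipschitz field of linear growth bounded and globally Lipschitz. *)
Definition rV_clamp (x : 'rV[R]_n) : 'rV[R]_n := \row_j clamp (- r) r (x 0 j).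

Let rr : - r <= r. Proof. by rewrite (le_trans _ r0)// oppr_le0. Qed.

Lemma rV_clamp_le x : `|rV_clamp x| <= r.
Proof. by apply/rV_norm_leP => // j; rewrite mxE ler_norml clamp_itv. Qed.

Lemma rV_clamp_id x : `|x| <= r -> rV_clamp x = x.
Proof.
move=> /(rV_norm_leP _ r0) xr; apply/rowP => j; rewrite mxE clamp_id//.
by rewrite -ler_norml.
Qed.

Lemma rV_clamp_lipschitz x y : `|rV_clamp x - rV_clamp y| <= `|x - y|.
Proof.
apply/rV_norm_leP => // j; apply: le_trans (coord_le_norm _ j).
by rewrite !mxE clamp_lipschitz.
Qed.

Lemma rV_clamp_le_norm x : `|rV_clamp x| <= `|x|.
Proof.
have := rV_clamp_lipschitz x 0.
by rewrite (@rV_clamp_id 0) ?normr0// !subr0.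
Qed.

End Clamp.

Section Existence.
Context {R : realType} {n : nat}.
Notation mu := (@lebesgue_measure R).

(* The iterates are equi-Lipschitz, so they have an ultralimit; consecutive iterates
   become close, which makes this limit a fixed point. *)
Lemma picard (g : R -> 'rV[R]_n -> 'rV[R]_n) (M L t : R) x0 :
  t < 0 -> 0 < L ->
  (forall X : R -> 'rV[R]_n, borel_fun X -> borel_fun (fun s => g s (X s))) ->
  (forall s x, `|g s x| <= M) ->
  (forall s x y, `|g s x - g s y| <= L * `|x - y|) ->
  exists Z : R -> 'rV[R]_n, [/\ Z t = x0,
    forall s r, `|Z s - Z r| <= M * `|s - r| &
    {ae mu, forall s, s \in `[t, 0] -> is_derive s 1 Z (g s (Z s))}].
Proof.
move=> t0 L0 gb gM gL.
have M0 : 0 <= M := le_trans (normr_ge0 _) (gM 0 0).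
pose P (X Y : R -> 'rV[R]_n) := [/\ Y t = x0,
    forall s r, `|Y s - Y r| <= M * `|s - r| &
    {ae mu, forall s, s \in `[t, 0] -> is_derive s 1 Y (g s (X s))}].
have Pex X : borel_fun X -> exists Y, P X Y.
  by move=> bX; apply: lipschitz_primitive_rV => //; exact: gb.
pose step X := if pselect (exists Y, P X Y) is left h then sval (cid h) else X.
have stepP X : borel_fun X -> P X (step X).
  by move=> /Pex h; rewrite /step; case: pselect => // h'; case: cid.
pose X k := iter k step (cst x0).
have XP k : X k t = x0 /\ forall s r, `|X k s - X k r| <= M * `|s - r|.
  elim: k => [|k [_ IH]]; first by split=> // s r; rewrite subrr normr0 mulr_ge0.
  by have [] := stepP _ (lipschitz_borel IH).
have Xb k : borel_fun (X k) := lipschitz_borel (XP k).2.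
have XS k : P (X k) (X k.+1) := stepP _ (Xb k).
have lipac (Y : R -> 'rV[R]_n) : (forall s r, `|Y s - Y r| <= M * `|s - r|) ->
    forall j, abs_cont t 0 (fun s => Y s 0 j).
  by move=> lip j; apply: abs_cont_coord; exact: absolutely_continuous_lipschitz lip.
(* Bounds the first increment: the initial iterate is constant and the next one is [M]-Lipschitz on
   an interval of length [- t]. *)
pose C := M * - t.
have C0 : 0 <= C by rewrite mulr_ge0// oppr_ge0 ltW.
have gau s : s \in `[t, 0] -> 1 <= gauge L t s.
  by rewrite in_itv/= => /andP[ts _]; rewrite gauge_ge1// ltW.
have Xdiff k s : s \in `[t, 0] -> `|X k.+1 s - X k s| <= C / 2 ^+ k * gauge L t s.
  elim: k s => [|k IH] s st.
    rewrite expr0 divr1; apply: le_trans (_ : C <= _); last by rewrite ler_peMr// gau.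
    have [X1t X1M _] := XS 0%N; rewrite -[X 0%N s]/x0 -X1t; apply: le_trans (X1M _ _) _.
    move: st; rewrite in_itv/= => /andP[ts s0].
    by rewrite ler_wpM2l// ger0_norm ?subr_ge0//; lra.
  rewrite exprSr invfM mulrA.
  apply: (@growth_halving _ _ (fun s => X k.+2 s - X k.+1 s) L (C / 2 ^+ k) t 0) => //.
  - by rewrite divr_ge0// exprn_ge0.
  - by apply: abs_contB_coord; apply: lipac; apply: (XP _).2.
  - by rewrite !(XP _).1 subrr.
  have [_ _ d1] := XS k; have [_ _ d2] := XS k.+1.
  apply: ae_imply (ae_conj d1 d2) => r [dr1 dr2] rt.
  exists (g r (X k.+1 r) - g r (X k r)).
    by apply: is_deriveB_rV; [exact: dr2|exact: dr1].
  by apply: le_trans (gL _ _ _) _; rewrite -mulrA ler_wpM2l ?(ltW L0)// IH.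
have [U [UU oU]] := ultraFilterLemma (@eventually_filter).
have [Y [Yt YM YU]] := ultra_uniform_limit UU t0 (fun k => (XP k).1) (fun k => (XP k).2).
(* The ultralimit [Y] is not yet known to solve anything; [Z] has the velocities [g s (Y s)], so it
   remains to prove [Z = Y]. *)
have [Zt ZM dZ] := stepP Y (lipschitz_borel YM); set Z := step Y in Zt ZM dZ.
have YZ s : s \in `[t, 0] -> Z s = Y s.
  move=> st; apply/eqP; rewrite -subr_eq0 -normr_le0; apply/ler_addgt0Pr => e e0.
  rewrite add0r.
  have ga0 : 0 < gauge L t s := expR_gt0 _.
  (* [Z - Y] is split at two consecutive iterates into three terms; dividing by the gauge at [s]
     offsets the weight in the first two. *)
  pose e1 := e / 3 / gauge L t s.
  have e10 : 0 < e1 by rewrite !divr_gt0.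
  have e1e : e1 <= e / 3 by rewrite ler_pdivrMr// ler_peMr ?gau// ltW// divr_gt0.
  have e1g : e1 * gauge L t s = e / 3 by rewrite divfK// gt_eqF.
  have [N Ne] := exists_half_pow_lt C e10.
  have UN : U [set k | (N <= k)%N] by apply: oU; exists N.
  have [k [/= kY Nk]] := filter_ex (filterI (YU _ e10) UN).
  have h1 : `|X k.+1 s - X k s| <= e / 3.
    apply: le_trans (Xdiff k s st) _; rewrite -e1g ler_pM2r// (le_trans _ (ltW Ne))//.
    by rewrite ler_wpM2l// lef_pV2 ?posrE ?exprn_gt0// ler_eXn2l// ltr1n.
  have h2 : `|X k.+1 s - Z s| <= e1 / 2 * gauge L t s.
    apply: (@growth_halving _ _ (fun s => X k.+1 s - Z s) L e1 t 0) => //.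
    - exact: ltW.
    - by apply: abs_contB_coord; apply: lipac => //; apply: (XP _).2.
    - by rewrite (XP _).1 Zt subrr.
    have [_ _ d1] := XS k; apply: ae_imply (ae_conj d1 dZ) => r [dr1 dr2] rt.
    exists (g r (X k r) - g r (Y r)).
      by apply: is_deriveB_rV; [exact: dr1|exact: dr2].
    apply: le_trans (gL _ _ _) _; rewrite -mulrA ler_wpM2l ?(ltW L0)//.
    by apply: le_trans (kY r rt) _; rewrite ler_peMr ?gau// ltW.
  have h3 : `|X k.+1 s - Z s| <= e / 3.
    apply: le_trans h2 _; rewrite -e1g ler_pM2r// ler_pdivrMr// ler_peMr ?ltW//.
    by rewrite ltr1n.
  have h4 := kY s st.
  rewrite (_ : Z s - Y s = (X k.+1 s - X k s) - (X k.+1 s - Z s) + (X k s - Y s)); last first.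
    by apply/rowP => j; rewrite !mxE; ring.
  rewrite (_ : e = e / 3 + e / 3 + e / 3); last by field.
  apply: le_trans (ler_normD _ _) _; apply: lerD; last exact: le_trans e1e.
  by apply: le_trans (ler_normB _ _) _; exact: lerD.
exists Z; split => //.
by apply: ae_imply dZ => s h st; rewrite YZ//; exact: h.
Qed.

Context {p q : nat}.
Variables (A : set 'rV[R]_p) (B : set 'rV[R]_q).
Variable f : 'rV[R]_n -> 'rV[R]_p -> 'rV[R]_q -> 'rV[R]_n.
Variables (t K : R).
Hypothesis t0 : t < 0.
Hypothesis fc : jointly_continuous A B f.
Hypothesis K0 : 0 < K.
Hypothesis fK : forall x a b, A a -> B b -> `|f x a b| <= K * (`|x| + 1).
Hypothesis fL : forall r, 0 < r -> exists2 L, 0 < L & forall a b x x', A a -> B b ->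
  `|x| <= r -> `|x'| <= r -> `|f x a b - f x' a b| <= L * `|x - x'|.

(** The bound of [linear_growth_bound] at the final time, common to all solutions from [x0] whatever
    the signals. *)
Definition reach (x0 : 'rV[R]_n) := `|x0| + (`|x0| + 1) * gauge K t 0.

Lemma reach_ge0 x0 : 0 <= reach x0.
Proof. by rewrite addr_ge0// mulr_ge0 ?expR_ge0// addr_ge0. Qed.

Lemma growth_reach x0 (x : R -> 'rV[R]_n) :
  absolutely_continuous t 0 x -> x t = x0 ->
  {ae mu, forall s, s \in `[t, 0] ->
     exists2 d, is_derive s 1 x d & `|d| <= K * (`|x s| + 1)} ->
  forall s, s \in `[t, 0] -> `|x s| <= reach x0.
Proof.
move=> acx xt aex s st; apply: le_trans (linear_growth_bound K0 acx xt aex st) _.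
rewrite lerD2l ler_wpM2l ?addr_ge0// ler_expR ler_wpM2l ?mulr_ge0 ?(ltW K0)//.
by move: st; rewrite in_itv/= lerD2r => /andP[].
Qed.

(** The field truncated at radius [r] falls under [picard]. Truncation preserves the linear growth
    bound, so the solution stays within [reach x0], where the field was not changed. *)
Lemma carath_exists x0 (a : R -> 'rV[R]_p) (b : R -> 'rV[R]_q) :
  borel_fun a -> borel_fun b -> (forall s, A (a s)) -> (forall s, B (b s)) ->
  exists x, is_solution f t x0 a b x.
Proof.
move=> ba bb Aa Bb.
pose r := reach x0 + 1; have r0 : 0 < r by rewrite ltr_wpDl// reach_ge0.
have r0' := ltW r0.
have [L L0 LP] := fL r0.
have [|||Z [Zt ZM dZ]] := @picard (fun s x => f (rV_clamp r x) (a s) (b s)) (K * (r + 1)) L t x0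
  t0 L0.
- move=> X bX; apply: (borel_fun_comp3 (A := A) (B := B)) => //.
  move=> U oU; apply: (bX (rV_clamp r @^-1` U)).
  rewrite openE => x /= Ux; have [e e0 eU] := rV_open_norm oU Ux.
  apply/nbhs_ballP; exists e => //= y; rewrite -ball_normE /ball_/= => xy.
  have h : `|rV_clamp r y - rV_clamp r x| < e.
    by apply: le_lt_trans (rV_clamp_lipschitz r0' y x) _; rewrite distrC.
  exact: eU.
- move=> s x; apply: le_trans (fK _ (Aa s) (Bb s)) _.
  by rewrite ler_wpM2l ?(ltW K0)// lerD2r rV_clamp_le.
- move=> s x y.
  apply: le_trans (LP _ _ _ _ (Aa s) (Bb s) (rV_clamp_le r0' x) (rV_clamp_le r0' y)) _.
  by rewrite ler_wpM2l ?(ltW L0)// rV_clamp_lipschitz.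
have acZ := @absolutely_continuous_lipschitz R n t 0 _ Z ZM.
have Zr s : s \in `[t, 0] -> `|Z s| <= r.
  move=> st; apply: (@le_trans _ _ (reach x0)); last by rewrite lerDl.
  apply: growth_reach acZ Zt _ s st.
  apply: ae_imply dZ => s h /h dZ; exists (f (rV_clamp r (Z s)) (a s) (b s)) => //.
  apply: le_trans (fK _ (Aa s) (Bb s)) _.
  by rewrite ler_wpM2l ?(ltW K0)// lerD2r rV_clamp_le_norm.
exists Z; split => //.
by apply: ae_imply dZ => s h st; have := h st; rewrite rV_clamp_id// Zr.
Qed.

Lemma is_solution_ae x0 a b a' b' x :
  {ae mu, forall s, s \in `[t, 0] -> a' s = a s} ->
  {ae mu, forall s, s \in `[t, 0] -> b' s = b s} ->
  is_solution f t x0 a' b' x -> is_solution f t x0 a b x.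
Proof.
move=> aea aeb [xt acx dx]; split => //.
apply: ae_imply (ae_conj dx (ae_conj aea aeb)) => s [h [ha hb]] st.
by rewrite -(ha st) -(hb st); exact: h.
Qed.

Lemma trajectory_solution x0 a b : signals t A a -> signals t B b ->
  is_solution f t x0 a b (trajectory f t x0 a b).
Proof.
move=> sa sb; apply: xgetPex.
have [a' [ba Aa aea]] := signal_borel t0 sa.
have [b' [bb Bb aeb]] := signal_borel t0 sb.
have [x xsol] := carath_exists x0 ba bb Aa Bb.
by exists x; exact: is_solution_ae xsol.
Qed.

Lemma solution_growth x0 a b x : signals t A a -> signals t B b ->
  is_solution f t x0 a b x ->
  {ae mu, forall s, s \in `[t, 0] ->
     exists2 d, is_derive s 1 x d & `|d| <= K * (`|x s| + 1)}.
Proof.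
move=> sa sb [_ _ dx]; apply: ae_imply dx => s h st.
by exists (f (x s) (a s) (b s)); [exact: h|apply: fK; [exact: sa.1|exact: sb.1]].
Qed.

Lemma solution_bound x0 a b x : signals t A a -> signals t B b ->
  is_solution f t x0 a b x -> forall s, s \in `[t, 0] -> `|x s| <= reach x0.
Proof.
move=> sa sb sol; have [xt acx _] := sol.
by apply: growth_reach acx xt _; exact: solution_growth sol.
Qed.

Lemma solution_lipschitz x0 a b x : signals t A a -> signals t B b ->
  is_solution f t x0 a b x -> forall s r, s \in `[t, 0] -> r \in `[t, 0] ->
  `|x s - x r| <= K * (reach x0 + 1) * `|s - r|.
Proof.
move=> sa sb sol; have [xt acx _] := sol.
have key s r : t <= s -> s <= r -> r <= 0 -> `|x r - x s| <= K * (reach x0 + 1) * (r - s).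
  move=> ts sr rz; apply: abs_cont_norm_le => //.
  - by rewrite mulr_ge0 ?(ltW K0)// addr_ge0 ?reach_ge0.
  - exact: abs_cont_coord_sub acx.
  apply: ae_imply (solution_growth sa sb sol) => z h; rewrite in_itv/= => /andP[sz zr].
  have zt : z \in `[t, 0] by rewrite in_itv/= (le_trans ts)//= (le_trans zr).
  have [d dx dK] := h zt; exists d => //; apply: le_trans dK _.
  by rewrite ler_wpM2l ?(ltW K0)// lerD2r; exact: (solution_bound sa sb sol zt).
move=> s r; rewrite !in_itv/= => /andP[ts sz] /andP[tr rz].
have [sr|/ltW rs] := leP s r.
  by rewrite distrC (distrC s) (@ger0_norm _ (r - s)) ?subr_ge0 ?key.
by rewrite (@ger0_norm _ (s - r)) ?subr_ge0 ?key.
Qed.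

(** Stated up to an intermediate time [v], which makes trajectories under non-anticipative
    strategies, and then their limits, depend on the past only. *)
Lemma solution_unique x0 a1 b1 x1 a2 b2 x2 v :
  signals t A a1 -> signals t B b1 -> signals t A a2 -> signals t B b2 ->
  is_solution f t x0 a1 b1 x1 -> is_solution f t x0 a2 b2 x2 -> v \in `[t, 0] ->
  a1 = a2 %[ae lebesgue_measure in `[t, v]%classic] ->
  b1 = b2 %[ae lebesgue_measure in `[t, v]%classic] ->
  forall s, s \in `[t, v] -> x1 s = x2 s.
Proof.
move=> sa1 sb1 sa2 sb2 sol1 sol2 vt aea aeb.
have [x1t acx1 dx1] := sol1; have [x2t acx2 dx2] := sol2.
have v0 : v <= 0 by move: vt; rewrite in_itv/= => /andP[].
have sub s : s \in `[t, v] -> s \in `[t, 0].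
  by rewrite !in_itv/= => /andP[-> sv]; exact: le_trans v0.
pose r := reach x0 + 1; have r0 : 0 < r by rewrite ltr_wpDl// reach_ge0.
have [L L0 LP] := fL r0.
have bnd a b x : signals t A a -> signals t B b -> is_solution f t x0 a b x ->
    forall s, s \in `[t, v] -> `|x s| <= r.
  move=> sa sb sol s sv; apply: (@le_trans _ _ (reach x0)); last by rewrite lerDl.
  exact: (solution_bound sa sb sol (sub s sv)).
apply: (@carath_unique R n t v L (fun s x => f x (a1 s) (b1 s)) x1 x2 r) => //.
- exact: ltW.
- exact: abs_cont_coord_sub acx1.
- exact: abs_cont_coord_sub acx2.
- by rewrite x1t x2t.
- exact: bnd sol1.
- exact: bnd sol2.
- by move=> s z z' sv zr z'r; apply: LP => //; [apply: sa1.1|apply: sb1.1]; exact: sub.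
- by apply: ae_imply dx1 => s h sv; exact: h (sub s sv).
have aea' : {ae mu, forall s, s \in `[t, v] -> a1 s = a2 s} := aea.
have aeb' : {ae mu, forall s, s \in `[t, v] -> b1 s = b2 s} := aeb.
apply: ae_imply (ae_conj dx2 (ae_conj aea' aeb')) => s [h [ha hb]] sv.
by rewrite ha// hb//; exact: h (sub s sv).
Qed.

End Existence.

(** * Separation and limits of trajectories *)

Section Support.
Context {R : realType}.

Definition dot n (x y : 'rV[R]_n) : R := \sum_(j < n) x 0 j * y 0 j.

Lemma dotC n (x y : 'rV[R]_n) : dot x y = dot y x.
Proof. by apply: eq_bigr => j _; rewrite mulrC. Qed.

Lemma dotDr n (x y z : 'rV[R]_n) : dot x (y + z) = dot x y + dot x z.
Proof. by rewrite -big_split; apply: eq_bigr => j _; rewrite mxE mulrDr. Qed.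

Lemma dotZr n (x y : 'rV[R]_n) c : dot x (c *: y) = c * dot x y.
Proof. by rewrite mulr_sumr; apply: eq_bigr => j _; rewrite mxE mulrCA. Qed.

Lemma dotBr n (x y z : 'rV[R]_n) : dot x (y - z) = dot x y - dot x z.
Proof. by rewrite dotDr -scaleN1r dotZr mulN1r. Qed.

Lemma dot_norm_le n (x y : 'rV[R]_n) : `|dot x y| <= n%:R * `|x| * `|y|.
Proof.
apply: le_trans (ler_norm_sum _ _ _) _.
rewrite -[n in n%:R](card_ord n) -mulrA mulr_natl -sumr_const; apply: ler_sum => j _.
by rewrite normrM ler_pM// coord_le_norm.
Qed.

Lemma dot_ge0 n (x : 'rV[R]_n) : 0 <= dot x x.
Proof. by apply: sumr_ge0 => j _; rewrite -expr2 sqr_ge0. Qed.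

Lemma dot_eq0 n (x : 'rV[R]_n) : dot x x = 0 -> x = 0.
Proof.
move/eqP; rewrite psumr_eq0; last by move=> j _; rewrite -expr2 sqr_ge0.
move=> /allP h; apply/rowP => j; rewrite mxE; apply/eqP.
by have := h j (mem_index_enum _); rewrite /= mulf_eq0 orbb.
Qed.

Lemma continuous_on_dot n (C : set 'rV[R]_n) x : continuous_on C (dot x).
Proof.
move=> b Cb e e0; have M0 : 0 < n%:R * `|x| + 1 by rewrite ltr_wpDl// mulr_ge0.
exists (e / (n%:R * `|x| + 1)); first exact: divr_gt0.
move=> b' _; rewrite ltr_pdivlMr// -dotBr => h; apply: le_lt_trans (dot_norm_le _ _) _.
by apply: le_lt_trans h; rewrite mulrC ler_wpM2l// lerDl.
Qed.

Lemma continuous_on_dist_sq n (C : set 'rV[R]_n) w :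
  continuous_on C (fun c => dot (w - c) (w - c)).
Proof.
move=> b Cb e e0.
have M0 : 0 < n%:R * (`|w - b| + `|w - b| + 1) + 1.
  by rewrite ltr_wpDl// mulr_ge0// !addr_ge0.
exists (Num.min 1 (e / (n%:R * (`|w - b| + `|w - b| + 1) + 1))).
  by rewrite lt_min ltr01 divr_gt0.
move=> b' _; rewrite lt_min ltr_pdivlMr// => /andP[h1 h2].
rewrite (_ : _ - _ = dot (b' - b) ((b' - b) - 2 *: (w - b))); last first.
  rewrite /dot -sumrB; apply: eq_bigr => j _; rewrite !mxE; ring.
apply: le_lt_trans (dot_norm_le _ _) _; apply: le_lt_trans h2.
rewrite mulrC mulrA mulrC ler_wpM2l// mulrC.
apply: (@le_trans _ _ (n%:R * (`|w - b| + `|w - b| + 1))); last by rewrite lerDl.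
rewrite ler_wpM2l//; apply: le_trans (ler_normB _ _) _.
by rewrite normrZ ger0_norm// mulrDl mul1r addrC lerD2l ltW.
Qed.

Lemma mem_convex_compact n (C : set 'rV[R]_n) w :
  C !=set0 -> compact C -> convex_set C ->
  (forall xi : 'rV[rat]_n, exists2 c, C c &
     dot (map_mx ratr xi) w <= dot (map_mx ratr xi) c) -> C w.
Proof.
move=> C0 cC convC hw.
have [c0 /set_mem Cc0 cmin] :=
  EVT_min_rV C0 cC (continuous_on_within (@continuous_on_dist_sq n C w)).
pose xi0 := w - c0; pose dl := dot xi0 xi0.
have [dl0|] := eqVneq dl 0.
  by move: (dot_eq0 dl0) => /eqP; rewrite subr_eq0 => /eqP ->.
rewrite neq_lt ltNge dot_ge0/= => dl0.
(* The variational inequality of the projection: move from [c0] towards [c] by a small [lam], expand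
   the squared distance and divide by [lam]. *)
have var c : C c -> dot xi0 (c - c0) <= 0.
  move=> Cc; apply/ler_addgt0Pr => e e0; rewrite add0r.
  pose S := dot (c - c0) (c - c0).
  have S0 : 0 <= S := dot_ge0 _.
  pose lam := Num.min 1 (e / (S + 1)).
  have lam0 : 0 < lam by rewrite lt_min ltr01 divr_gt0// ltr_wpDl.
  have lam1 : lam <= 1 by rewrite ge_min lexx.
  have lame : lam * S <= e.
    apply: (@le_trans _ _ (e / (S + 1) * S)).
      by rewrite ler_wpM2r// ge_min lexx orbT.
    rewrite -mulrA ler_piMr// ?(ltW e0)// mulrC ler_pdivrMr ?ltr_wpDl//.
    by rewrite mul1r lerDl.
  have Cl : C (lam *: c + (1 - lam) *: c0).
    exact: set_mem (convC c c0 (Itv01 (ltW lam0) lam1) (mem_set Cc) (mem_set Cc0)).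
  have := cmin _ (mem_set Cl).
  rewrite (_ : dot (w - (lam *: c + (1 - lam) *: c0)) _ =
    dl - 2 * lam * dot xi0 (c - c0) + lam * lam * S); last first.
    rewrite /dl /S /dot !mulr_sumr -sumrB -big_split/=; apply: eq_bigr => j _.
    by rewrite /xi0 !mxE; ring.
  rewrite -/dl => h.
  have : 2 * dot xi0 (c - c0) <= lam * S.
    by rewrite -(ler_pM2l lam0); lra.
  lra.
have [M [_ CM]] := compact_bounded cC.
pose M1 := `|M| + 1.
have CM1 c : C c -> `|c| <= M1.
  by apply: CM; rewrite ltr_pwDr// ler_norm.
(* [N] exceeds [n%:R] times the norm of [w - c] for every [c] in [C], so a direction within [dl / N]
   of [xi0] changes the product with [w - c] by less than [dl]. *)
pose N := n%:R * (`|w| + M1) + 1.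
have N0 : 0 < N by rewrite ltr_wpDl// mulr_ge0// !addr_ge0.
have [i [xi0i ie]] := rV_box_basis xi0 (divr_gt0 dl0 N0).
have qi : rV_box i (map_mx ratr i.1 : 'rV[R]_n).
  by move=> j; rewrite mxE subrr normr0 invr_gt0.
have [c Cc hc] := hw i.1.
have := ie _ qi; rewrite ltr_pdivlMr// => h1.
have h2 : dot xi0 (w - c) >= dl.
  rewrite (_ : w - c = xi0 - (c - c0)); last by rewrite /xi0; apply/rowP => j; rewrite !mxE; ring.
  by rewrite dotBr -/dl; have := var c Cc; lra.
have h3 : dot (map_mx ratr i.1 - xi0) (w - c) <= - dl.
  rewrite dotC dotBr -dotC (dotC (w - c) xi0).
  have : dot (map_mx ratr i.1) (w - c) <= 0 by rewrite dotBr; lra.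
  lra.
have : dl <= `|dot (map_mx ratr i.1 - xi0) (w - c)|.
  by rewrite -normrN (le_trans _ (ler_norm _))//; lra.
move=> /le_trans/(_ (dot_norm_le _ _)) h4.
suff : dl < dl by rewrite ltxx.
apply: le_lt_trans h4 _; apply: le_lt_trans h1.
rewrite mulrC mulrA mulrC ler_wpM2l// mulrC.
apply: (@le_trans _ _ (n%:R * (`|w| + M1))); last by rewrite lerDl.
by rewrite ler_wpM2l// (le_trans (ler_normB _ _))// lerD2l CM1.
Qed.

End Support.

(** * The differential inclusion for limit paths and a control that realizes it *)

Section Inclusion.
Context {R : realType} {n p q : nat}.
Notation mu := (@lebesgue_measure R).

Lemma abs_cont_dot (u v : R) (xi : 'rV[R]_n) (X : R -> 'rV[R]_n) :
  (forall j, abs_cont u v (fun s => X s 0 j)) -> abs_cont u v (fun s => dot xi (X s)).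
Proof.
move=> acX; rewrite /dot; elim: (index_enum _) => [|j l IH].
  rewrite (_ : (fun _ => _) = fun=> 0); first exact: abs_cont_cst.
  by apply/funext => s; rewrite big_nil.
rewrite (_ : (fun _ => _) =
    fun s => xi 0 j * X s 0 j + \sum_(i <- l) xi 0 i * X s 0 i).
  by apply: abs_contD => //; exact: abs_contZ.
by apply/funext => s; rewrite big_cons.
Qed.

Lemma is_derive_dot (xi : 'rV[R]_n) (X : R -> 'rV[R]_n) (s : R) d :
  is_derive s 1 X d -> is_derive s 1 (fun r => dot xi (X r)) (dot xi d).
Proof.
move=> /is_derive_coordP dX; apply/is_derive_epsP => e e0.
pose N := \sum_(j < n) `|xi 0 j| + 1.
have N0 : 0 < N by rewrite ltr_wpDl// sumr_ge0.
have eN0 : 0 < e / N by rewrite divr_gt0.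
have /choice[r rP] j : exists r, 0 < r /\ forall y, `|y - s| < r ->
    `|X y 0 j - X s 0 j - d 0 j * (y - s)| <= e / N * `|y - s|.
  by have [r r0 rP] := (is_derive_epsP _ _ _).1 (dX j) _ eN0; exists r.
exists (\big[Num.min/1]_j r j).
  by apply: lt_bigmin => // j _; have [] := rP j.
move=> y ys; rewrite -dotBr -[dot xi d * _]mulrC -dotZr -dotBr.
apply: le_trans (ler_norm_sum _ _ _) _.
apply: (@le_trans _ _ (\sum_(j < n) `|xi 0 j| * (e / N * `|y - s|))).
  apply: ler_sum => j _; rewrite normrM ler_wpM2l// !mxE [(y - s) * _]mulrC.
  by have [_ h] := rP j; apply: h; apply: lt_le_trans ys _; exact: bigmin_le.
rewrite -mulr_suml mulrA ler_wpM2r// mulrC -mulrA ler_piMr ?(ltW e0)//.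
by rewrite mulrC ler_pdivrMr// mul1r lerDl.
Qed.

Lemma derive_le0 (phi : R -> R) (s d r : R) : is_derive s 1 phi d -> 0 < r ->
  (forall y, s < y -> y < s + r -> phi y <= phi s) -> d <= 0.
Proof.
move=> /is_derive_epsP dphi r0 h; apply/ler_addgt0Pr => e e0; rewrite add0r.
have [r' r'0 rP] := dphi e e0.
pose z := Num.min r r' / 2.
have z0 : 0 < z by rewrite divr_gt0// lt_min r0.
have [zr zr'] : z < r /\ z < r'.
  have m0 : 0 < Num.min r r' by rewrite lt_min r0.
  have zm : z < Num.min r r' by rewrite ltr_pdivrMr// ltr_pMr// ltr1n.
  by move: zm; rewrite lt_min => /andP[].
have h1 : phi (s + z) <= phi s by apply: h; rewrite ?ltrDl ?ltrD2l.
have := rP (s + z); rewrite addrAC subrr add0r (gtr0_norm z0) => /(_ zr').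
rewrite ler_norml => /andP[h2 _].
rewrite -(ler_pM2r z0); lra.
Qed.

Variables (A : set 'rV[R]_p) (B : set 'rV[R]_q).
Variable f : 'rV[R]_n -> 'rV[R]_p -> 'rV[R]_q -> 'rV[R]_n.
Variables (t K : R).
Hypothesis t0 : t < 0.
Hypotheses (B0 : B !=set0) (cB : compact B).
Hypothesis fc : jointly_continuous A B f.
Hypothesis K0 : 0 < K.
Hypothesis fK : forall x a b, A a -> B b -> `|f x a b| <= K * (`|x| + 1).
Hypothesis fL : forall r, 0 < r -> exists2 L, 0 < L & forall a b (x x' : 'rV[R]_n), A a -> B b ->
  `|x| <= r -> `|x'| <= r -> `|f x a b - f x' a b| <= L * `|x - x'|.

Lemma open_dot_gt (xi : 'rV[R]_n) c : open [set y | c < dot xi y].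
Proof.
rewrite openE => y /= cy.
have e0 : 0 < dot xi y - c by rewrite subr_gt0.
have [d d0 hd] := @continuous_on_dot R n setT xi y I _ e0.
apply/nbhs_ballP; exists d => //= z; rewrite -ball_normE /ball_/= distrC => /(hd z I).
by rewrite ltr_distl => /andP[h _]; move: h; rewrite opprB addrCA subrr addr0.
Qed.

Lemma continuous_on_field x a : A a ->
  forall b, B b -> forall e, 0 < e -> exists2 d, 0 < d &
    forall b', B b' -> `|b' - b| < d -> `|f x a b' - f x a b| < e.
Proof.
move=> Aa b Bb e e0; have [d d0 hd] := fc x Aa Bb e0.
by exists d => // b' Bb' bb'; apply: hd; rewrite ?subrr ?normr0.
Qed.

Lemma continuous_on_dot_field (xi x : 'rV[R]_n) a : A a ->
  continuous_on B (fun b => dot xi (f x a b)).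
Proof.
move=> Aa b Bb e e0.
have [d d0 hd] := @continuous_on_dot R n setT xi (f x a b) I _ e0.
have [d' d'0 hd'] := continuous_on_field x Aa Bb d0.
by exists d' => // b' Bb' bb'; apply: hd => //; exact: hd'.
Qed.

(** [g] is the support function of the velocity set. It exceeds [c] exactly when some member of a
    countable dense family of [B] does, so the maximizers [bm] may be chosen without regard to
    measurability. *)
Lemma support_measurable (xi : 'rV[R]_n) (Y : R -> 'rV[R]_n) a :
  borel_fun Y -> borel_fun a -> (forall s, A (a s)) ->
  exists g : R -> R, [/\ measurable_fun setT g,
    forall s b, B b -> dot xi (f (Y s) (a s) b) <= g s &
    forall s, exists2 b, B b & g s = dot xi (f (Y s) (a s) b)].
Proof.
move=> bY ba Aa.
have gex s : exists b, B b /\ forall b', B b' ->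
    dot xi (f (Y s) (a s) b') <= dot xi (f (Y s) (a s) b).
  have [b /set_mem Bb bmax] := EVT_max_rV B0 cB
    (continuous_on_within (continuous_on_dot_field xi (Y s) (Aa s))).
  by exists b; split => // b' /mem_set; exact: bmax.
have /choice[bm bmP] := gex.
exists (fun s => dot xi (f (Y s) (a s) (bm s))); split; last 2 first.
- by move=> s b Bb; exact: (bmP s).2.
- by move=> s; exists (bm s) => //; exact: (bmP s).1.
have [D [BD dD]] := dense_family B0.
apply: measurable_fun_gt => c.
rewrite (_ : mkset _ = \bigcup_i [set s | c < dot xi (f (Y s) (a s) (D i))]).
  apply: countable_bigcupT_measurable; [exact: countableP|move=> i].
  have := borel_fun_comp3 fc bY ba (borel_fun_cst (D i)) Aa (fun=> BD i).
  by move=> /(_ _ (@open_dot_gt xi c)).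
apply/seteqP; split => s /=.
  move=> cs; have e0 : 0 < dot xi (f (Y s) (a s) (bm s)) - c by rewrite subr_gt0.
  have [d d0 hd] := continuous_on_dot_field xi (Y s) (Aa s) (bmP s).1 e0.
  have [i /(hd _ (BD i))] := dD _ _ (bmP s).1 d0.
  by rewrite ltr_distl opprB addrCA subrr addr0 => /andP[h _]; exists i.
by move=> [i _ /= h]; apply: lt_le_trans h _; exact: (bmP s).2.
Qed.

Variable (x0 : 'rV[R]_n).

Lemma lipschitz_rV_derivable_ae (M : R) (Y : R -> 'rV[R]_n) :
  (forall s r, `|Y s - Y r| <= M * `|s - r|) ->
  {ae mu, forall s, s \in `[t, 0] -> derivable Y s 1}.
Proof.
move=> YM.
have lt1 : t - 1 < 1 by rewrite ltrBlDr (lt_trans t0)// addr_gt0.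
have : {ae mu, forall s, forall j, s \in `]t - 1, 1[ -> derivable (fun r => Y r 0 j) s 1}.
  apply: ae_forall_countable => j; apply: (@lipschitz_derivable_ae _ _ M) lt1.
  move=> x y; apply: le_trans (YM x y); apply: le_trans (coord_le_norm _ j).
  by rewrite !mxE.
apply: ae_imply => s h st; apply/derivable_mxP => i j; rewrite (ord1 i).
apply: h; move: st; rewrite !in_itv/= => /andP[h1 h2].
by rewrite ltrBlDr (le_lt_trans h1) ?ltrDl// (le_lt_trans h2).
Qed.

(* Each [xi . X] with [X] close to [Y] grows at most like the primitive of the support
   function of the velocity set along [Y], up to an error that vanishes in the limit. *)
Lemma limit_inclusion (M : R) (Y : R -> 'rV[R]_n) a :
  (forall x a, A a -> convex_set (f x a @` B)) ->
  signals t A a -> Y t = x0 ->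
  (forall s r, `|Y s - Y r| <= M * `|s - r|) ->
  (forall d, 0 < d -> exists b X, [/\ signals t B b, is_solution f t x0 a b X &
     forall s, s \in `[t, 0] -> `|X s - Y s| <= d]) ->
  {ae mu, forall s, s \in `[t, 0] -> derivable Y s 1 /\
     exists2 b, B b & f (Y s) (a s) b = 'D_1 Y s}.
Proof.
move=> fconv sa Yt YM Yapp.
have [a' [ba Aa aea]] := signal_borel t0 sa.
(* Clamping time keeps [Y] bounded by [C] on the whole line, so that the support function is bounded
   at all times and has a Lipschitz primitive. *)
have t0' := ltW t0; pose cl := clamp t 0.
have clid s : s \in `[t, 0] -> cl s = s by rewrite in_itv; exact: clamp_id.
have clt s : t <= cl s <= 0 by exact: clamp_itv.
pose C := `|x0| + `|M| * - t.
have M0 : 0 <= `|M| by [].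
have YC s : `|Y (cl s)| <= C.
  rewrite -[Y (cl s)](subrK x0) addrC; apply: le_trans (ler_normD _ _) _.
  rewrite lerD2l -{1}Yt; apply: le_trans (YM _ _) _.
  have /andP[h1 h2] := clt s.
  rewrite (ger0_norm (_ : 0 <= cl s - t)) ?subr_ge0//.
  apply: (@le_trans _ _ (`|M| * (cl s - t))); first by rewrite ler_wpM2r ?subr_ge0// ler_norm.
  by rewrite ler_wpM2l//; lra.
have C0 : 0 <= C := le_trans (normr_ge0 _) (YC 0).
have bYc : borel_fun (fun s => Y (cl s)).
  apply: (@lipschitz_borel _ _ _ `|M|) => s r; apply: le_trans (YM _ _) _.
  apply: (@le_trans _ _ (`|M| * `|cl s - cl r|)); first by rewrite ler_wpM2r// ler_norm.
  by rewrite ler_wpM2l// clamp_lipschitz.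
have key (xi : 'rV[rat]_n) : {ae mu, forall s, s \in `[t, 0] -> derivable Y s 1 ->
    exists2 b, B b & dot (map_mx ratr xi) ('D_1 Y s) <=
      dot (map_mx ratr xi) (f (Y (cl s)) (a' s) b)}.
  set z := map_mx ratr xi.
  have [g [mg gub gatt]] := support_measurable z bYc ba Aa.
  have gM s : `|g s| <= n%:R * `|z| * (K * (C + 1)).
    have [b Bb ->] := gatt s; apply: le_trans (dot_norm_le _ _) _.
    rewrite ler_wpM2l ?mulr_ge0//; apply: le_trans (fK _ (Aa s) Bb) _.
    by rewrite ler_wpM2l ?(ltW K0)// lerD2r YC.
  have [G [_ GM dG]] := lipschitz_primitive t0 mg gM.
  have acG u v : abs_cont u v (fun s => -1 * G s).
    apply: abs_contZ; apply: abs_cont_lipschitz => x y _ xy _.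
    by apply: le_trans (GM _ _) _; rewrite (ger0_norm (_ : 0 <= y - x)) ?subr_ge0.
  have [L L0 LP] := fL (ltr_wpDl C0 (ltr01 : 0 < 1 :> R)).
  (* The comparison is made on increments over [[u, v]], which pass to the limit, and is
     differentiated only afterwards. *)
  have mono u v : t <= u -> u <= v -> v <= 0 ->
      dot z (Y v) - G v <= dot z (Y u) - G u.
    move=> tu uv v0; apply/ler_addgt0Pr => e e0.
    pose nz := n%:R * `|z|.
    have nz0 : 0 <= nz by rewrite mulr_ge0.
    (* Replacing [X] by [Y] costs [nz * d] at each end and [nz * (L * d)] per unit of time inside,
       in total at most [d * Q]. Taking [d <= 1] keeps [X] in the ball of radius [C + 1] to which
       [L] belongs. *)
    pose Q := nz * (L * (v - u) + 2) + 1.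
    have Q0 : 0 < Q.
      by rewrite ltr_wpDl// mulr_ge0// addr_ge0// mulr_ge0 ?(ltW L0)// subr_ge0.
    pose d := Num.min 1 (e / Q).
    have d0 : 0 < d by rewrite lt_min ltr01 divr_gt0.
    have [b [X [sb [Xt acX dX] XY]]] := Yapp d d0.
    have acXuv := abs_cont_coord_sub tu v0 acX.
    have := abs_cont_le (M := nz * (L * d)) uv (abs_contD (abs_cont_dot z acXuv) (acG u v)).
    have inc s : u <= s -> s <= v -> s \in `[t, 0].
      by move=> us sv; rewrite in_itv/= (le_trans tu us) (le_trans sv v0).
    move=> H; have {}H : dot z (X v) + -1 * G v - (dot z (X u) + -1 * G u) <=
      nz * (L * d) * (v - u).
      apply: H; apply: ae_imply (ae_conj dX (ae_conj dG aea)) => s [hX [hG ha]].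
      rewrite in_itv/= => /andP[us sv]; have st := inc s us sv.
      exists (dot z (f (X s) (a s) (b s)) + -1 * g s); last first.
        apply: is_deriveD; first exact: (is_derive_dot z (hX st)).
        exact: (is_deriveZ (-1) (hG st)).
      rewrite mulN1r lerBlDr addrC.
      have := gub s (b s) (sb.1 s st); rewrite clid// ha// => gs.
      rewrite -[X in dot z X](subrK (f (Y s) (a s) (b s))) dotDr addrC lerD//.
      apply: le_trans (ler_norm _) _; apply: le_trans (dot_norm_le _ _) _.
      rewrite ler_wpM2l//; apply: le_trans (LP _ _ _ _ (sa.1 s st) (sb.1 s st) _ _) _.
      - rewrite -[X s](subrK (Y s)) addrC; apply: le_trans (ler_normD _ _) _.
        apply: lerD; first by have := YC s; rewrite clid.
        by apply: le_trans (XY s st) _; rewrite /d ge_min lexx.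
      - by have := YC s; rewrite clid// => /le_trans; apply; rewrite lerDl.
      - by rewrite ler_wpM2l ?(ltW L0)// XY.
    have XYd s : s \in `[t, 0] -> `|dot z (X s) - dot z (Y s)| <= nz * d.
      move=> st; rewrite -dotBr; apply: le_trans (dot_norm_le _ _) _.
      by rewrite ler_wpM2l// XY.
    have := XYd v (inc v uv (lexx v)); have := XYd u (inc u (lexx u) uv).
    rewrite !ler_distl => /andP[h1 h2] /andP[h3 h4].
    have : d * Q <= e by rewrite -ler_pdivlMr// /d ge_min lexx orbT.
    have : 0 <= d := ltW d0.
    rewrite /Q; nra.
  (* At [s = 0] there is no room on the right for the sign argument of [derive_le0]. *)
  have ne0 : {ae mu, forall s, s != 0}.
    exists [set 0]; split; [exact: measurable_set1|exact: lebesgue_measure_set1|].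
    by move=> s /= /negP; rewrite negbK => /eqP.
  apply: ae_imply (ae_conj dG ne0) => s [hG s0] st dY.
  have [b Bb gb] := gatt s; exists b => //; rewrite -gb -subr_le0.
  have dphi : is_derive s 1 (fun r => dot z (Y r) + -1 * G r) (dot z ('D_1 Y s) + -1 * g s).
    apply: is_deriveD; first exact: (is_derive_dot z (DeriveDef dY erefl)).
    exact: (is_deriveZ (-1) (hG st)).
  rewrite -mulN1r; move: (st); rewrite in_itv/= => /andP[ts sz].
  apply: (derive_le0 dphi (r := - s)); first by rewrite oppr_gt0 lt_neqAle s0.
  move=> y sy; rewrite subrr => y0; rewrite !mulN1r.
  by apply: mono => //; exact: ltW.
have := ae_forall_countable key.
move=> keyall; apply: ae_imply (ae_conj keyall (ae_conj aea (lipschitz_rV_derivable_ae YM))).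
move=> s [hk [ha hY]] st; have dY := hY st; split => //.
have : (f (Y s) (a s) @` B) ('D_1 Y s).
  apply: mem_convex_compact.
  - by have [b Bb] := B0; exists (f (Y s) (a s) b); exists b.
  - apply: continuous_compact => //; apply/subspace_continuousP => b Bb.
    apply/cvgrPdist_lt => e e0.
    have [d d0 hd] := continuous_on_field (Y s) (sa.1 s st) Bb e0.
    have := nbhsx_ballx b d d0; rewrite near_withinE; apply: filterS => b'.
    rewrite -ball_normE /ball_/= distrC => bb' Bb'; rewrite distrC; exact: hd.
  - exact: fconv _ _ (sa.1 s st).
  move=> xi; have [b Bb hb] := hk xi st dY; exists (f (Y s) (a s) b); first by exists b.
  by move: hb; rewrite clid// ha.
by move=> [b Bb <-]; exists b.
Qed.

Lemma measurable_rV_norm (v : R -> 'rV[R]_n) : borel_fun v ->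
  measurable_fun setT (fun s => `|v s|).
Proof.
move=> bv; apply: measurable_fun_gt => c; apply: (bv [set y | c < `|y|]).
apply: (@open_comp _ _ (fun y : 'rV[R]_n => `|y|) [set z | c < z]); last exact: open_gt.
by move=> y _; exact: norm_continuous.
Qed.

(** The coordinatewise upper limit of difference quotients with steps [1/(k+1)]; the Lipschitz bound
    makes it finite at every time, differentiable or not. *)
Lemma derive_borel_ae (M : R) (Y : R -> 'rV[R]_n) :
  (forall s r, `|Y s - Y r| <= M * `|s - r|) ->
  exists2 w : R -> 'rV[R]_n, borel_fun w &
    forall s, derivable Y s 1 -> w s = 'D_1 Y s.
Proof.
move=> YM; have /borel_fun_coordP bY := lipschitz_borel YM.
pose dq j k s := k.+1%:R * (Y (s + k.+1%:R^-1) 0 j - Y s 0 j).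
have dqM j k s : `|dq j k s| <= M.
  rewrite normrM ger0_norm// mulrC -ler_pdivlMr//.
  have -> : Y (s + k.+1%:R^-1) 0 j - Y s 0 j = (Y (s + k.+1%:R^-1) - Y s) 0 j by rewrite !mxE.
  apply: le_trans (coord_le_norm _ _) _; apply: le_trans (YM _ _) _.
  by rewrite addrAC subrr add0r ger0_norm// invr_ge0.
exists (fun s => \row_j limn_sup (fun k => dq j k s)).
  apply/borel_fun_coordP => j.
  rewrite (_ : (fun s => _) = fun s => limn_sup (fun k => dq j k s)); last first.
    by apply/funext => s; rewrite mxE.
  apply: measurable_fun_limn_sup.
  - by move=> s _; exists M => _ [k _ <-]; apply: le_trans (ler_norm _) (dqM j k s).
  - by move=> s _; exists (- M) => _ [k _ <-]; have := dqM j k s; rewrite ler_norml => /andP[].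
  move=> k; apply: measurable_funM => //; apply: measurable_funB => //.
  have bYk : borel_fun (fun s => Y (s + k.+1%:R^-1)).
    apply: (@lipschitz_borel _ _ _ M) => s r; apply: le_trans (YM _ _) _.
    by rewrite opprD addrACA subrr addr0.
  exact: (borel_fun_coordP _).1 bYk j.
move=> s dY; apply/rowP => j; rewrite mxE.
have dYj := (is_derive_coordP _ _ _).1 (DeriveDef dY erefl) j.
have cv : dq j k s @[k --> \oo] --> 'D_1 Y s 0 j.
  apply/cvgrPdist_le => e e0.
  have [r r0 rP] := (is_derive_epsP _ _ _).1 dYj _ e0.
  have := near_infty_natSinv_lt (PosNum r0); apply: filterS => k /= kr.
  have := rP (s + k.+1%:R^-1); rewrite addrAC subrr add0r ger0_norm ?invr_ge0//.
  move=> /(_ kr) h.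
  have kk : k.+1%:R * k.+1%:R^-1 = 1 :> R by rewrite divff.
  rewrite (_ : _ - dq j k s = k.+1%:R *
    - (Y (s + k.+1%:R^-1) 0 j - Y s 0 j - 'D_1 Y s 0 j * k.+1%:R^-1)); last first.
    have kkD : k.+1%:R * ('D_1 Y s 0 j / k.+1%:R) = 'D_1 Y s 0 j by rewrite mulrCA kk mulr1.
    by rewrite mulrN mulrBr kkD opprB.
  rewrite normrM normrN ger0_norm//; apply: le_trans (ler_wpM2l _ h) _ => //.
  by rewrite mulrCA kk mulr1.
exact: (cvg_limn_inf_sup cv).2.
Qed.

Lemma selector_mem b0 (Z : set 'rV[R]_q) : Z `<=` B -> B b0 -> B (selector b0 Z).
Proof.
move=> ZB Bb0; rewrite /selector; case: xgetP => // b _ /lex_min_sub; exact: ZB.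
Qed.

(** The control is defined from the given [a] and the actual derivative, hence pointwise in time;
    measurability is proved for the Borel versions [a'] and [w], which yield the same control off a
    null set. *)
Lemma measurable_control (M : R) (Y : R -> 'rV[R]_n) a b0 :
  B b0 -> signals t A a ->
  (forall s r, `|Y s - Y r| <= M * `|s - r|) ->
  {ae mu, forall s, s \in `[t, 0] -> derivable Y s 1 /\
     exists2 b, B b & f (Y s) (a s) b = 'D_1 Y s} ->
  let c s := selector b0 [set b | B b /\ f (Y s) (a s) b = 'D_1 Y s] in
  signals t B c /\
  {ae mu, forall s, s \in `[t, 0] -> is_derive s 1 Y (f (Y s) (a s) (c s))}.
Proof.
move=> Bb0 sa YM aeY c.
have [a' [ba Aa aea]] := signal_borel t0 sa.
have [w bw wP] := derive_borel_ae YM.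
have bY := lipschitz_borel YM.
have [N [mN N0 NP]] := ae_conj aeY aea.
have good s : ~ N s -> s \in `[t, 0] -> [/\ derivable Y s 1,
    exists2 b, B b & f (Y s) (a s) b = 'D_1 Y s & a' s = a s].
  move=> nNs st; apply: contrapT => h; apply/nNs/NP => /= -[h1 h2]; apply: h.
  by have [dY eb] := h1 st; split => //; exact: h2.
pose D := `[t, 0]%classic `\` N.
have mD : measurable D by apply: measurableD => //; exact: measurable_itv.
(* Setting [Phi] to 0 off [D] provides a zero at the exceptional times as well. *)
pose Phi s b := if `[< D s >] then `|f (Y s) (a' s) b - w s| else 0.
have cPhi : carath B Phi.
  split.
  - move=> b Bb.
    have mh : measurable_fun setT (fun s => `|f (Y s) (a' s) b - w s|).
      apply: measurable_rV_norm; apply/borel_fun_coordP => j.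
      rewrite (_ : (fun s => _) = fun s => f (Y s) (a' s) b 0 j - w s 0 j); last first.
        by apply/funext => s; rewrite !mxE.
      apply: measurable_funB; last exact: (borel_fun_coordP _).1 bw j.
      apply: (borel_fun_coordP (fun s => f (Y s) (a' s) b)).1.
      exact: borel_fun_comp3 fc bY ba (borel_fun_cst b) Aa (fun=> Bb).
    have := measurable_funTS (D := D) mh; move/(measurable_restrictT _ mD) => h.
    rewrite (_ : Phi^~ b = (fun s => `|f (Y s) (a' s) b - w s|) \_ D) //.
  - move=> s; rewrite /Phi; case: asboolP => _; last first.
      by move=> b Bb e e0; exists 1 => // b' _ _; rewrite subrr normr0.
    move=> b Bb e e0; have [d d0 hd] := continuous_on_field (Y s) (Aa s) Bb e0.
    exists d => // b' Bb' bb'; apply: le_lt_trans (ler_dist_dist _ _) _.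
    by rewrite opprB addrA subrK; exact: hd.
  - by move=> s b Bb; rewrite /Phi; case: asboolP.
  - move=> s; rewrite /Phi; case: asboolP => [[st nNs]|_]; last by exists b0.
    have [dY [b Bb fb] aa] := good s nNs st; exists b => //.
    by rewrite aa fb wP// subrr normr0.
have [bsel selZ] := selectorP B0 cB b0 cPhi.
have cE s : ~ N s -> s \in `[t, 0] -> selector b0 (zeros B Phi s) = c s.
  move=> nNs st; have [dY _ aa] := good s nNs st.
  rewrite /c; congr selector; apply/seteqP; split => b /=.
    move=> [Bb]; rewrite /Phi; case: asboolP => [_|[]//].
    by move/eqP; rewrite normr_eq0 subr_eq0 aa wP// => /eqP.
  move=> [Bb fb]; split => //; rewrite /Phi; case: asboolP => // _.
  by rewrite aa fb wP// subrr normr0.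
have aeN : {ae mu, forall s, ~ N s}.
  by exists N; split => // s /=; exact: contrapT.
split.
  apply: borel_signal bsel _.
    by move=> s _; apply: selector_mem => // b [].
  by apply: ae_imply aeN => s nNs st; exact: cE.
apply: ae_imply aeN => s nNs st; have [dY [b Bb fb] aa] := good s nNs st.
suff -> : f (Y s) (a s) (c s) = 'D_1 Y s by exact: DeriveDef.
have [Bc] := selZ s; rewrite (cE s nNs st) /Phi; case: asboolP => [_|[]//].
by move/eqP; rewrite normr_eq0 subr_eq0 aa wP// => /eqP.
Qed.
End Inclusion.

(** * The infimum over strategies is attained *)

Section Attained.
Context {R : realType} {n p q : nat}.
Notation mu := (@lebesgue_measure R).

Lemma continuous_functional_near (t : R) (J : paths R n t -> R) (X : paths R n t) :
  {within continuous_paths t, continuous J} -> continuous_paths t X ->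
  forall e, 0 < e -> exists2 d, 0 < d & forall Y : paths R n t, continuous_paths t Y ->
    (forall s, s \in `[t, 0] -> `|Y s - X s| < d) -> `|J Y - J X| < e.
Proof.
move=> /subspace_continuousP cJ cX e e0.
have /cvgrPdist_lt /(_ _ e0) := cJ X cX; rewrite near_withinE.
rewrite /prop_near1 => /uniform_nbhs[E [entE EP]].
move: entE; rewrite -entourage_ballE => -[d /= d0 dE].
exists d => // Y cY XY; rewrite distrC; apply: EP => // s st.
by apply: dE; rewrite /= -ball_normE /ball_/= distrC; exact: XY.
Qed.

Variables (A : set 'rV[R]_p) (B : set 'rV[R]_q).
Variable f : 'rV[R]_n -> 'rV[R]_p -> 'rV[R]_q -> 'rV[R]_n.
Variables (t K : R).
Hypothesis t0 : t < 0.
Hypotheses (B0 : B !=set0) (cB : compact B).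
Hypothesis fc : jointly_continuous A B f.
Hypothesis K0 : 0 < K.
Hypothesis fK : forall x a b, A a -> B b -> `|f x a b| <= K * (`|x| + 1).
Hypothesis fL : forall r, 0 < r -> exists2 L, 0 < L & forall a b (x x' : 'rV[R]_n), A a -> B b ->
  `|x| <= r -> `|x'| <= r -> `|f x a b - f x' a b| <= L * `|x - x'|.
Hypothesis fconv : forall x a, A a -> convex_set (f x a @` B).
Variables (J : paths R n t -> R) (x0 : 'rV[R]_n) (c : R).
Hypothesis cJ : {within continuous_paths t, continuous J}.

Lemma strategy_attained (gam : nat -> (R -> 'rV[R]_p) -> (R -> 'rV[R]_q)) :
  (forall k, strategies t A B (gam k)) ->
  (forall k a, signals t A a -> J (trajectory f t x0 a (gam k a)) <= c + k.+1%:R^-1) ->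
  exists2 gamma, strategies t A B gamma &
    forall a, signals t A a -> J (trajectory f t x0 a (gamma a)) <= c.
Proof.
move=> gamS gamJ; have [b0 Bb0] := B0.
have [U [UU oU]] := ultraFilterLemma (@eventually_filter).
pose T k a : R -> 'rV[R]_n := trajectory f t x0 a (gam k a).
have Tsol k a : signals t A a -> is_solution f t x0 a (gam k a) (T k a).
  by move=> sa; apply: (trajectory_solution t0 fc K0 fK fL) => //; exact: (gamS k).1.
pose cl := clamp t 0.
have clid s : s \in `[t, 0] -> cl s = s by rewrite in_itv; exact: clamp_id.
have clt s : cl s \in `[t, 0] by rewrite in_itv; exact: clamp_itv (ltW t0).
(* [trajectory] is arbitrary outside [[t, 0]]; the clamped path is Lipschitz on the whole line. *)
pose X k a s := T k a (cl s).
pose M := K * (reach t K x0 + 1).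
have M0 : 0 <= M by rewrite mulr_ge0 ?(ltW K0)// addr_ge0 ?reach_ge0.
have XM k a : signals t A a -> forall s r, `|X k a s - X k a r| <= M * `|s - r|.
  move=> sa s r.
  have := solution_lipschitz K0 fK sa ((gamS k).1 a sa) (Tsol k a sa) (clt s) (clt r).
  by move=> /le_trans; apply; rewrite ler_wpM2l// clamp_lipschitz// ltW.
have tt : t \in `[t, 0] by rewrite in_itv/= lexx ltW.
have Xt k a : signals t A a -> X k a t = x0.
  by move=> sa; rewrite /X clid//; have [] := Tsol k a sa.
pose P a (Y : R -> 'rV[R]_n) := [/\ Y t = x0, forall s r, `|Y s - Y r| <= M * `|s - r| &
  forall e, 0 < e -> U [set k | forall s, s \in `[t, 0] -> `|X k a s - Y s| <= e]].
have /choice[Y YP] a : exists Y, signals t A a -> P a Y.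
  have [sa|nsa] := pselect (signals t A a); last by exists (cst x0).
  have [|k|Y PY] := @ultra_uniform_limit _ _ U (X^~ a) M t x0 UU t0; last by exists Y.
    by move=> k; exact: Xt.
  exact: XM.
have Yinc a : signals t A a -> {ae mu, forall s, s \in `[t, 0] -> derivable (Y a) s 1 /\
     exists2 b, B b & f (Y a s) (a s) b = 'D_1 (Y a) s}.
  move=> sa; have [Yt YM YU] := YP a sa.
  apply: (limit_inclusion t0 B0 cB fc K0 fK fL fconv sa Yt YM) => d d0.
  have [k /= kd] := filter_ex (YU d d0).
  exists (gam k a), (T k a); split; [exact: (gamS k).1|exact: Tsol|move=> s st].
  by have := kd s st; rewrite /X clid.
(* Both limits are taken along [U], so some index [k] is good for both, and at that index the two
   trajectories agree up to [v]. *)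
have YT a1 a2 v : signals t A a1 -> signals t A a2 -> v \in `[t, 0] ->
    a1 = a2 %[ae lebesgue_measure in `[t, v]%classic] ->
    forall s, s \in `[t, v] -> Y a1 s = Y a2 s.
  move=> sa1 sa2 vt aea s sv.
  have st : s \in `[t, 0].
    move: sv vt; rewrite !in_itv/= => /andP[-> sv] /andP[_]; exact: le_trans sv.
  have [_ _ YU1] := YP a1 sa1; have [_ _ YU2] := YP a2 sa2.
  apply/eqP; rewrite -subr_eq0 -normr_le0; apply/ler_addgt0Pr => e e0; rewrite add0r.
  have e2 : 0 < e / 2 by rewrite divr_gt0.
  have [k /= [/(_ s st) h1 /(_ s st) h2]] := filter_ex (filterI (YU1 _ e2) (YU2 _ e2)).
  have Xeq : X k a1 s = X k a2 s.
    rewrite /X clid//.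
    apply: (solution_unique K0 fK fL sa1 ((gamS k).1 a1 sa1) sa2 ((gamS k).1 a2 sa2)
      (Tsol k a1 sa1) (Tsol k a2 sa2) vt aea) => //.
    exact: (gamS k).2 aea.
  rewrite (_ : Y a1 s - Y a2 s = (X k a2 s - Y a2 s) - (X k a1 s - Y a1 s)); last first.
    by rewrite Xeq; apply/rowP => j; rewrite !mxE; ring.
  by rewrite (splitr e); apply: le_trans (ler_normB _ _) _; exact: lerD h2 h1.
pose gamma a s := selector b0 [set b | B b /\ f (Y a s) (a s) b = 'D_1 (Y a) s].
have gammaP a : signals t A a -> signals t B (gamma a) /\
    is_solution f t x0 a (gamma a) (Y a).
  move=> sa; have [Yt YM _] := YP a sa.
  have [sg dY] := measurable_control t0 B0 cB fc Bb0 sa YM (Yinc a sa).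
  by split => //; split => //; exact: absolutely_continuous_lipschitz YM.
exists gamma.
  split; first by move=> a /gammaP[].
  move=> a1 a2 v sa1 sa2 vt aea.
  have Yeq := YT a1 a2 v sa1 sa2 vt aea.
  have aea' : {ae mu, forall s, s \in `[t, v] -> a1 s = a2 s} := aea.
  (* A derivative looks at both sides of [s]; once the end points [t] and [v] are discarded,
     agreement on [[t, v]] determines it. *)
  have ne0 z : {ae mu, forall s, s != z}.
    exists [set z]; split; [exact: measurable_set1|exact: lebesgue_measure_set1|].
    by move=> s /= /negP; rewrite negbK => /eqP.
  suff : {ae mu, forall s, s \in `[t, v] -> gamma a1 s = gamma a2 s} by [].
  apply: ae_imply (ae_conj aea' (ae_conj (ne0 t) (ne0 v))) => s [ha [st sv]] stv.
  have dYeq : 'D_1 (Y a1) s = 'D_1 (Y a2) s.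
    apply: near_eq_derive.
    have : s \in `]t, v[.
      by move: stv; rewrite !in_itv/= !lt_neqAle (eq_sym t) st sv => /andP[-> ->].
    move=> /near_in_itvoo; apply: filterS => r rtv; apply: Yeq.
    by move: rtv; rewrite !in_itv/= => /andP[/ltW-> /ltW->].
  by rewrite /gamma dYeq (Yeq s stv) (ha stv).
move=> a sa; have [sg solY] := gammaP a sa.
(* The solution picked by [trajectory] need not be [Y a] as a function on the line; uniqueness
   identifies them on [[t, 0]]. *)
set Z := trajectory f t x0 a (gamma a).
have Zsol : is_solution f t x0 a (gamma a) Z by exact: (trajectory_solution t0 fc K0 fK fL).
have t00 : (0 : R) \in `[t, 0] by rewrite in_itv/= lexx ltW.
have ZY s : s \in `[t, 0] -> Z s = Y a s.
  apply: (solution_unique K0 fK fL sa sg sa sg Zsol solY t00).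
    by apply: aeW.
  by apply: aeW.
have cpath b (x : paths R n t) : is_solution f t x0 a b x -> continuous_paths t x.
  by move=> [_ acx _]; exact: absolutely_continuous_within acx.
apply/ler_addgt0Pr => e e0; have e2 : 0 < e / 2 by rewrite divr_gt0.
have [d d0 hd] := continuous_functional_near cJ (cpath _ _ Zsol) e2.
have [_ _ YU] := YP a sa.
have d2 : 0 < d / 2 by rewrite divr_gt0.
have UN : U [set k | k.+1%:R^-1 < e / 2].
  by apply: oU; exact: near_infty_natSinv_lt (PosNum e2).
have [k /= [kd ke]] := filter_ex (filterI (YU _ d2) UN).
have := hd (T k a) (cpath _ _ (Tsol k a sa)) _.
have := gamJ k a sa; rewrite -/(T k a) => h1 h2.
have : `|J (T k a) - J Z| < e / 2.
  apply: h2 => s st; rewrite ZY//; have := kd s st; rewrite /X clid// => h.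
  by apply: le_lt_trans h _; rewrite ltr_pdivrMr// ltr_pMr// ltr1n.
rewrite ltr_distl => /andP[h3 _].
have ke' : k.+1%:R^-1 <= e / 2 := ltW ke.
by rewrite (splitr e) addrA -lerBlDr (le_trans (ltW h3))// (le_trans h1)// lerD2l.
Qed.

End Attained.

(** * The losing and guaranteed sets as level sets of the value *)

Theorem theorem1 (R : realType) (n p q : nat) (t : R)
  (A : set 'rV[R]_p) (B : set 'rV[R]_q)
  (f : 'rV[R]_n -> 'rV[R]_p -> 'rV[R]_q -> 'rV[R]_n)
  (F : set (paths R n t)) (J : paths R n t -> R) :
  t < 0 ->
  A !=set0 -> compact A ->
  B !=set0 -> compact B ->
  {within setT `*` A `*` B, continuous (fun z => f z.1.1 z.1.2 z.2)} ->
  (exists2 K : R, 0 < K & forall x a b, A a -> B b ->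
     enorm (f x a b) <= K * (enorm x + 1)) ->
  (forall r : R, 0 < r -> exists2 L : R, 0 < L &
     forall a b x x', A a -> B b -> enorm x < r -> enorm x' < r ->
       enorm (f x a b - f x' a b) <= L * enorm (x - x')) ->
  (forall x a, A a -> convex_set (f x a @` B)) ->
  F `<=` continuous_paths t -> closed F ->
  (exists M : R, forall x, continuous_paths t x -> `|J x| <= M) ->
  {within continuous_paths t, continuous J} ->
  F = [set x | continuous_paths t x /\ J x <= 0] ->
  losing_set f A B F = [set x | value f A B J x > 0] /\
  guaranteed_set f A B F = [set x | value f A B J x <= 0].
Proof.
move=> t0 [a0 Aa0] _ B0 cB fcont [K K0 fK] fL fconv _ _ [M JM] cJ FE.
have fc : jointly_continuous A B f.
  move=> x a b Aa Bb e e0; move: fcont => /subspace_continuousP/(_ (x, a, b)).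
  move=> /(_ (conj (conj I Aa) Bb))/cvgrPdist_lt/(_ _ e0).
  rewrite near_withinE => /nbhs_ballP[d /= d0 hd].
  exists d => // x' a' b' Aa' Bb' xx aa bb; rewrite distrC.
  apply: (hd (x', a', b')) => //=.
  by split; [split|]; rewrite -ball_normE /ball_/= distrC.
(* The Euclidean hypotheses are transferred to the maximum norm; the factor [n%:R + 1] is positive
   even for [n = 0]. *)
have n0 : 0 <= n%:R :> R by [].
have n1 : 0 < n%:R + 1 :> R by rewrite ltr_wpDl.
have fK' x a b : A a -> B b -> `|f x a b| <= K * (n%:R + 1) * (`|x| + 1).
  move=> Aa Bb; apply: le_trans (norm_le_enorm _) _; apply: le_trans (fK _ _ _ Aa Bb) _.
  rewrite -mulrA ler_wpM2l ?(ltW K0)// mulrDl mulrDr mulr1 mul1r.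
  have := enorm_le_norm x; have := normr_ge0 x; lra.
have K0' : 0 < K * (n%:R + 1) by rewrite mulr_gt0.
have fL' r : 0 < r -> exists2 L, 0 < L & forall a b (x x' : 'rV[R]_n), A a -> B b ->
  `|x| <= r -> `|x'| <= r -> `|f x a b - f x' a b| <= L * `|x - x'|.
  (* The closed ball of radius [r] for the maximum norm lies in the open Euclidean ball of radius
     [n%:R * r + 1]. *)
  move=> r0; have r1 : 0 < n%:R * r + 1 by rewrite ltr_wpDl// mulr_ge0// ltW.
  have [L L0 LP] := fL _ r1.
  have er (x : 'rV[R]_n) : `|x| <= r -> enorm x < n%:R * r + 1.
    move=> xr; apply: le_lt_trans (enorm_le_norm x) _.
    by rewrite ltr_pwDr// ler_wpM2l.
  exists (L * (n%:R + 1)); first by rewrite mulr_gt0.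
  move=> a b x x' Aa Bb xr x'r; apply: le_trans (norm_le_enorm _) _.
  apply: le_trans (LP _ _ _ _ Aa Bb (er _ xr) (er _ x'r)) _.
  rewrite -mulrA ler_wpM2l ?(ltW L0)//; apply: le_trans (enorm_le_norm _) _.
  by rewrite ler_wpM2r// lerDl.
have trajc x a b : signals t A a -> signals t B b ->
    continuous_paths t (trajectory f t x a b).
  move=> sa sb; have [_ acx _] := trajectory_solution t0 fc K0' fK' fL' x sa sb.
  exact: absolutely_continuous_within acx.
have cst_signal m (C : set 'rV[R]_m) y : C y -> signals t C (cst y).
  move=> Cy; apply: (@borel_signal _ _ _ _ _ (cst y)); first by [].
    exact: borel_fun_cst.
  by apply: aeW.
have [b0 Bb0] := B0.
have gamma0 : strategies t A B (fun _ => cst b0).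
  by split=> [a _|a1 a2 s _ _ _ _]; [exact: cst_signal|apply: aeW].
pose S x gamma := [set J (trajectory f t x a (gamma a)) | a in signals t A].
have SM x gamma : strategies t A B gamma -> forall y, S x gamma y -> `|y| <= M.
  by move=> [sg _] _ [a sa <-]; apply: JM; apply: trajc => //; exact: sg.
(* [sup] and [inf] have the junk value 0 on empty or unbounded sets; constant signals and the bound
   [M] on [J] exclude this. *)
have Ssup x gamma : strategies t A B gamma -> has_sup (S x gamma).
  move=> sg; split.
    exists (J (trajectory f t x (cst a0) (gamma (cst a0)))).
    by exists (cst a0) => //; exact: cst_signal.
  by exists M => y /(SM x gamma sg); apply: le_trans; exact: ler_norm.
have vinf x : has_inf [set sup (S x gamma) | gamma in strategies t A B].
  split; first by exists (sup (S x (fun _ => cst b0))); exists (fun _ => cst b0).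
  exists (- M) => _ [gamma sg <-].
  have [[y Sy] _] := Ssup x gamma sg.
  apply: (@le_trans _ _ y); last exact: ub_le_sup (Ssup x gamma sg).2 _ Sy.
  by have := SM x gamma sg y Sy; rewrite ler_norml => /andP[].
have GE : guaranteed_set f A B F = [set x | value f A B J x <= 0].
  apply/seteqP; split => x /=.
    move=> [gamma sg gF]; apply: (@le_trans _ _ (sup (S x gamma))).
      by apply: ge_inf; [exact: (vinf x).2|exists gamma].
    apply: ge_sup; first exact: (Ssup x gamma sg).1.
    by move=> _ [a sa <-]; have := gF a sa; rewrite FE => -[].
  move=> v0.
  have /choice[gam gamP] k : exists gamma, strategies t A B gamma /\
      forall a, signals t A a -> J (trajectory f t x a (gamma a)) <= 0 + k.+1%:R^-1.
    have k0 : 0 < k.+1%:R^-1 :> R by rewrite invr_gt0.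
    have [_ [gamma sg <-] gk] := inf_adherent k0 (vinf x).
    exists gamma; split => // a sa; apply: (@le_trans _ _ (sup (S x gamma))).
      by apply: ub_le_sup (Ssup x gamma sg).2 _ _; exists a.
    by apply: le_trans (ltW gk) _; rewrite lerD2r.
  have [gamma sg gJ] := strategy_attained t0 B0 cB fc K0' fK' fL' fconv cJ
    (fun k => (gamP k).1) (fun k => (gamP k).2).
  exists gamma => // a sa; rewrite FE; split; last exact: gJ.
  by apply: trajc => //; exact: sg.1.
split => //; rewrite -[LHS]setCK -[RHS]setCK; congr (~` _).
transitivity (guaranteed_set f A B F).
  apply/seteqP; split => x /=.
    move=> /existsNP[gamma /not_implyP[sg nex]]; exists gamma => // a sa.
    by apply: contrapT => nF; apply: nex; exists a.
  by move=> [gamma sg gF] /(_ gamma sg)[a sa]; apply; exact: gF.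
rewrite GE; apply/seteqP; split => x /=; first by rewrite leNgt => /negP.
by move=> /negP; rewrite -leNgt.
Qed.
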